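(* Let $F\colon S(n)\to\mathbb{R}$ be a rotationally invariant, sublinear and degenerate elliptic operator with $F\not\equiv 0$, let $\Omega\subseteq\mathbb{R}^n$ be nonempty and open, and assume that $u$ is a viscosity supersolution of $F(\mathcal{H}w)=0$ in $\Omega$. Let $p\in[2,\infty]$ be the body cone aperture of the associated convex body of $F$. Then, in $\Omega$: 1. $u$ is dominative $p$-superharmonic. 2. $u$ is $p$-superharmonic. 3. $u$ is superharmonic. In particular, 4. if $p>n$, then $u$ is continuous; 5. if $p=\infty$, then $u$ is locally concave.
   Context: Here $n\geq 2$ and $S(n)$ is the space of symmetric real $n\times n$ matrices with inner product $\langle X,Y\rangle=\operatorname{tr}(XY)$, partially ordered by $X\leq Y$ iff $\xi^TX\xi\leq\xi^TY\xi$ for all $\xi\in\mathbb{R}^n$; $\lambda_{\max}(X)$ is the largest eigenvalue of $X$; $\mathcal{H}w$ is the Hessian matrix of $w$. A function $F\colon S(n)\to\mathbb{R}$ is sublinear if $F(X+Y)\leq F(X)+F(Y)$ and $F(tX)=tF(X)$ for all $X,Y\in S(n)$, $t\geq 0$; degenerate elliptic if $X\leq Y$ implies $F(X)\leq F(Y)$; rotationally invariant if $F(QXQ^T)=F(X)$ for all $X\in S(n)$ and all orthogonal $n\times n$ matrices $Q$. The associated convex body of a sublinear $F$ is the unique nonempty compact convex set $\mathcal{K}=\mathcal{K}_F\subseteq S(n)$ such that $F(X)=\max_{Y\in\mathcal{K}}\langle Y,X\rangle$ for all $X$. When $F$ is degenerate elliptic all matrices in $\mathcal{K}_F$ are positive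 semidefinite, and $F\not\equiv 0$ means $\mathcal{K}_F\neq\{0\}$. The solution cone aperture is $\alpha=\alpha(\mathcal{K}):=\min_{Z\in\mathcal{K},\,Z\neq 0}\frac{\operatorname{tr}Z}{\lambda_{\max}(Z)}\in[1,n]$, where the minimum is understood to be attained at some nonzero $Z\in\mathcal{K}$. The body cone aperture is $p=p(\mathcal{K}):=\frac{n+\alpha-2}{\alpha-1}$ if $1<\alpha\leq n$, and $p:=\infty$ if $\alpha=1$. A viscosity supersolution of an equation $G(\nabla w,\mathcal{H}w)=0$ (in particular of $F(\mathcal{H}w)=0$) in $\Omega$ is a function $u\colon\Omega\to(-\infty,\infty]$ that is lower semicontinuous, finite on a dense subset of $\Omega$, and such that whenever $x_0\in\Omega$ and a $C^2$ function $\phi$ satisfies $\phi(x_0)=u(x_0)$ and $\phi\leq u$ near $x_0$, then $G(\nabla\phi(x_0),\mathcal{H}\phi(x_0))\leq 0$. ''Dominative $p$-superharmonic'', ''$p$-superharmonic'' and ''superharmonic'' mean viscosity supersolution of, respectively, the dominative $p$-Laplace equation ($(p-2)\lambda_{\max}(\mathcal{H}w)+\Delta w=0$ for $2\leq p<\infty$, $\lambda_{\max}(\mathcal{H}w)=0$ for $p=\infty$), the $p$-Laplace equation ($\Delta_pw=\operatorname{div}(|\nabla w|^{p-2}\nabla w)=0$ for $2\leq p<\infty$, $\Delta_\infty w=\nabla w\,\mathcal{H}w\,\nabla w^T=0$ for $p=\infty$, with $\nabla w$ a row vector), and the Laplace equation $\Delta w=0$. *)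

(* Defs.v *)
(* Mathematical Components + MathComp-Analysis. *)
From HB Require Import structures.
From mathcomp Require Export all_boot all_order all_algebra.
From mathcomp Require Export all_classical all_reals all_analysis.

Set Implicit Arguments.
Unset Strict Implicit.
Unset Printing Implicit Defensive.

Import Order.TTheory GRing.Theory Num.Theory.
Export numFieldNormedType.Exports.

#[global] Open Scope classical_set_scope.
#[global] Open Scope ring_scope.

Definition is_maximum {R : realType} (A : set R) (m : R) := A m /\ ubound A m.
Definition is_minimum {R : realType} (A : set R) (m : R) := A m /\ lbound A m.

Section Operators.
Context {R : realType} {n : nat}.
Implicit Types (X Y Q : 'M[R]_n) (F : 'M[R]_n -> R) (K : set 'M[R]_n).

Definition Sym : set 'M[R]_n := [set X | X^T = X].

Definition inner X Y : R := \tr (X *m Y).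

Definition loewner_le X Y :=
  forall xi : 'cV[R]_n, (xi^T *m X *m xi) 0 0 <= (xi^T *m Y *m xi) 0 0.

(* The largest eigenvalue; a symmetric matrix of positive size has a nonempty
   finite set of real eigenvalues, so that the supremum is a maximum. *)
Definition lambda_max X : R := sup [set a | eigenvalue X a].

(* A function on S(n) is represented by F : 'M[R]_n -> R whose values outside
   Sym are irrelevant: every condition below only involves F on Sym. *)
Definition sublinear F :=
  (forall X Y, Sym X -> Sym Y -> F (X + Y) <= F X + F Y) /\
  (forall X (t : R), Sym X -> 0 <= t -> F (t *: X) = t * F X).

Definition degenerate_elliptic F :=
  forall X Y, Sym X -> Sym Y -> loewner_le X Y -> F X <= F Y.

Definition rotationally_invariant F :=
  forall X Q, Sym X -> Q *m Q^T = 1%:M -> F (Q *m X *m Q^T) = F X.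

Definition is_associated_body F K :=
  [/\ K !=set0, compact K, convex_set (K : set (convex_lmodType 'M[R]_n)),
      K `<=` Sym
    & forall X, Sym X -> is_maximum [set inner Y X | Y in K] (F X)].

(* For sublinear F there is exactly one such set. *)
Definition associated_body F : set 'M[R]_n := xget set0 (is_associated_body F).

Definition is_solution_cone_aperture K (alpha : R) :=
  is_minimum [set \tr Z / lambda_max Z | Z in K `\ 0] alpha.

End Operators.

Definition body_cone_aperture {R : realType} (n : nat) (alpha : R) : \bar R :=
  if alpha == 1 then +oo%E else ((n%:R + alpha - 2) / (alpha - 1))%:E.

Section Viscosity.
Context {R : realType} {n : nat}.
Implicit Types (phi : 'rV[R]_n -> R) (x : 'rV[R]_n) (Omega : set 'rV[R]_n)
  (u : 'rV[R]_n -> \bar R) (p : \bar R).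

Definition partial (i : 'I_n) phi : 'rV[R]_n -> R :=
  'D_(delta_mx 0 i : 'rV[R]_n) phi.

Definition C2_near phi x := \forall y \near x,
  [/\ {for y, continuous phi},
      forall i, derivable phi y (delta_mx 0 i : 'rV[R]_n) /\
        {for y, continuous (partial i phi)}
    & forall i j, derivable (partial i phi) y (delta_mx 0 j : 'rV[R]_n) /\
        {for y, continuous (partial j (partial i phi))}].

Definition grad phi x : 'rV[R]_n := \row_i partial i phi x.

Definition hessian phi x : 'M[R]_n :=
  \matrix_(i, j) partial i (partial j phi) x.

Definition laplacian phi x : R := \sum_i partial i (partial i phi) x.

(* The library norm on 'rV[R]_n is the sup norm. *)
Definition euclidean_norm (q : 'rV[R]_n) : R := Num.sqrt (\sum_i q 0 i ^+ 2).

(* In the next two definitions p ranges over [2, +oo]; p = -oo is junk.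
   At r = 2 the weight is 1 even where the gradient vanishes, as 0 `^ 0 = 1. *)
Definition dominative_p_laplacian p phi x : R :=
  if p is r%:E then (r - 2) * lambda_max (hessian phi x) + laplacian phi x
  else lambda_max (hessian phi x).

Definition p_laplacian p phi x : R :=
  if p is r%:E then
    \sum_i partial i
      (fun y => euclidean_norm (grad phi y) `^ (r - 2) * grad phi y 0 i) x
  else (grad phi x *m hessian phi x *m (grad phi x)^T) 0 0.

(* Viscosity supersolution in Omega of the second order equation L w = 0, with
   (L phi) x depending on phi only through its first and second derivatives at
   x.  The values of u outside Omega are irrelevant. *)
Definition viscosity_supersolution
    (L : ('rV[R]_n -> R) -> 'rV[R]_n -> R) Omega u :=
  [/\ forall x, Omega x -> u x != -oo%E,
      lower_semicontinuous (u : subspace Omega -> \bar R),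
      Omega `<=` closure (Omega `&` [set x | u x \is a fin_num])
    & forall x0 phi, Omega x0 -> C2_near phi x0 ->
        u x0 = (phi x0)%:E -> (\forall x \near x0, ((phi x)%:E <= u x)%E) ->
        L phi x0 <= 0].

Definition dominative_p_superharmonic p :=
  viscosity_supersolution (dominative_p_laplacian p).

Definition p_superharmonic p := viscosity_supersolution (p_laplacian p).

Definition superharmonic := viscosity_supersolution laplacian.

(* Continuity and concavity are those of real-valued functions, so both
   include the finiteness of u. *)
Definition continuous_in Omega u :=
  (forall x, Omega x -> u x \is a fin_num) /\ {within Omega, continuous u}.

Definition locally_concave Omega u :=
  forall x, Omega x -> exists2 r : R, 0 < r &
    [/\ ball x r `<=` Omega, forall y, ball x r y -> u y \is a fin_num
      & convex_function (ball x r : set (convex_lmodType 'rV[R]_n))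
          (fun y => - fine (u y))].

End Viscosity.

(* Main.v *)
From mathcomp Require Import fingroup perm.
Require Import Defs.
From mathcomp Require Import ring lra.

(* If F (D^2 phi) <= 0 and Z lies in the body of F, rotational invariance gives
   <Q Z Q^T, D^2 phi> <= 0 for all orthogonal Q.  Take for Z a minimizer of the
   aperture, align its top eigenvector with a vector q and average over the
   signed coordinate permutations fixing q: with c = (alpha - 1) / (n - 1),
   every q satisfies
     c |q|^2 tr (D^2 phi) + (1 - c) <D^2 phi q, q> <= 0.
   The three superharmonicity claims are instances of this inequality.  When
   p > n, that is alpha < 2, small powers -|x - y|^(2g) are strict
   subsolutions away from y, and comparison with them on balls gives a Hoelder
   estimate, hence finiteness and continuity.  When p = oo, c = 0 and
   comparison with quadratic functions gives concavity on segments. *)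

Set Implicit Arguments.
Unset Strict Implicit.
Unset Printing Implicit Defensive.
Import Order.TTheory GRing.Theory Num.Theory.

(** * Quadratic forms and the largest eigenvalue *)

Section LinearAlgebra.
Context {R : realType}.

(** The averaged matrix is determined by two numbers. Scaled to top eigenvalue 1, the aligned
    minimizer has trace alpha; the average leaves 1 in the direction q and spreads the remaining
    alpha - 1 evenly over the n - 1 orthogonal directions. For a unit vector q this is (1 - c) q q^T
    + c I, whence c. The body cone aperture is the p with c (p - 2) = 1 - c, that is p - 1 = 1/c. A
    top eigenvector as q yields the dominative p-Laplacian, the gradient yields the p-Laplacian, and
    summing over an orthonormal basis yields the Laplacian. Since u is only semicontinuous and
    finite on a dense set, the regularity claims rest on lower barriers alone: a function whose
    Hessian violates the inequality cannot touch u from below. For radial powers the violation reads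
    2g < 1 - c (n - 1) = (p - n)/(p - 1), the exponent of the fundamental solution of the
    p-Laplacian, so p > n is the threshold. *)

Definition dot n (u v : 'rV[R]_n) : R := (u *m v^T) 0 0.

Definition qform n (A : 'M[R]_n) (q : 'rV[R]_n) : R := dot (q *m A) q.

Lemma dotE n (u v : 'rV[R]_n) : dot u v = \sum_i u 0 i * v 0 i.
Proof. by rewrite /dot mxE; apply: eq_bigr => i _; rewrite mxE. Qed.

Lemma dotC n (u v : 'rV[R]_n) : dot u v = dot v u.
Proof. by rewrite !dotE; apply: eq_bigr => i _; rewrite mulrC. Qed.

Lemma dotDl n (u v w : 'rV[R]_n) : dot (u + v) w = dot u w + dot v w.
Proof. by rewrite /dot mulmxDl mxE. Qed.

Lemma dotZl n a (u w : 'rV[R]_n) : dot (a *: u) w = a * dot u w.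
Proof. by rewrite /dot -scalemxAl mxE. Qed.

Lemma dotDr n (u v w : 'rV[R]_n) : dot w (u + v) = dot w u + dot w v.
Proof. by rewrite dotC dotDl !(dotC w). Qed.

Lemma dotZr n a (u w : 'rV[R]_n) : dot w (a *: u) = a * dot w u.
Proof. by rewrite dotC dotZl (dotC w). Qed.

Lemma dotNl n (u w : 'rV[R]_n) : dot (- u) w = - dot u w.
Proof. by rewrite -scaleN1r dotZl mulN1r. Qed.

Lemma dotNr n (u w : 'rV[R]_n) : dot w (- u) = - dot w u.
Proof. by rewrite dotC dotNl dotC. Qed.

Lemma dot_mul n (u v : 'rV[R]_n) (A : 'M[R]_n) :
  dot (u *m A) v = dot u (v *m A^T).
Proof. by rewrite /dot trmx_mul trmxK mulmxA. Qed.

Lemma dot_ge0 n (u : 'rV[R]_n) : 0 <= dot u u.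
Proof. by rewrite dotE; apply: sumr_ge0 => i _; rewrite -expr2 sqr_ge0. Qed.

Lemma sqr_coord_le_dot n (u : 'rV[R]_n) i : u 0 i ^+ 2 <= dot u u.
Proof.
rewrite dotE (bigD1 i)//= expr2 lerDl.
by apply: sumr_ge0 => j _; rewrite -expr2 sqr_ge0.
Qed.

Lemma dot_eq0 n (u : 'rV[R]_n) : dot u u = 0 -> u = 0.
Proof.
move=> u0; apply/rowP => i; rewrite mxE; apply/eqP.
by rewrite -sqrf_eq0 eq_le sqr_ge0 andbT -u0 sqr_coord_le_dot.
Qed.

Lemma dot_gt0 n (u : 'rV[R]_n) : u != 0 -> 0 < dot u u.
Proof.
by move=> u0; rewrite lt_neqAle dot_ge0 eq_sym andbT; apply: contra_neq u0; exact: dot_eq0.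
Qed.

(** Discriminant argument: along v - t w with w = v M the form equals - 2 t |w|^2 + t^2 a, which is
    negative for small t > 0 unless w = 0. The choice t = s / (a + 1) is small enough and also
    covers a = 0. *)
Lemma psd_kernel n (M : 'M[R]_n) v : Sym M ->
  (forall w, 0 <= qform M w) -> qform M v = 0 -> v *m M = 0.
Proof.
move=> sM psd v0; set w := v *m M.
apply: dot_eq0; apply/eqP; rewrite eq_le dot_ge0 andbT leNgt; apply/negP => s0.
set s := dot w w in s0; set a := qform M w.
have a0 : 0 <= a by exact: psd.
have a1 : 0 < a + 1 by lra.
have := psd (v - (s / (a + 1)) *: w).
have -> : qform M (v - (s / (a + 1)) *: w) =
    - (s ^+ 2 / (a + 1)) * (2 - a / (a + 1)).
  rewrite /qform mulmxBl -scalemxAl -/w dotDl dotNl !dotDr !dotNr !dotZl !dotZr.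
  rewrite (_ : dot w v = 0) // (_ : dot (w *m M) v = s); last first.
    by rewrite dot_mul (sM : M^T = M).
  rewrite -/s -/(qform M w) -/a; field; lra.
rewrite mulNr oppr_ge0 leNgt => /negP; apply.
apply: mulr_gt0; first by rewrite divr_gt0// exprn_gt0.
have : a / (a + 1) <= 1 by rewrite ler_pdivrMr//; lra.
lra.
Qed.

Lemma cvg_sumr (T : Type) (F : set_system T) {FF : Filter F} (I : Type)
    (r : seq I) (P : pred I) (f : I -> T -> R) (l : I -> R) :
  (forall i, f i x @[x --> F] --> l i) ->
  (\sum_(i <- r | P i) f i x) @[x --> F] --> \sum_(i <- r | P i) l i.
Proof.
move=> fl; elim: r => [|i r IHr].
  by under eq_fun do rewrite big_nil; rewrite big_nil; exact: cvg_cst.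
under eq_fun do rewrite big_cons; rewrite big_cons.
by case: (P i) => //; apply: cvgD => //; exact: fl.
Qed.

Lemma cvg_dot (T : Type) (F : set_system T) {FF : Filter F} n
    (f g : T -> 'rV[R]_n) (a b : 'rV[R]_n) :
  (forall i, f x 0 i @[x --> F] --> a 0 i) ->
  (forall i, g x 0 i @[x --> F] --> b 0 i) ->
  dot (f x) (g x) @[x --> F] --> dot a b.
Proof.
move=> fa gb; rewrite dotE; under eq_fun do rewrite dotE.
by apply: cvg_sumr => i; exact: cvgM.
Qed.

Lemma cvg_mulmx (T : Type) (F : set_system T) {FF : Filter F} n
    (f : T -> 'rV[R]_n) (a : 'rV[R]_n) (A : 'M[R]_n) i :
  (forall i, f x 0 i @[x --> F] --> a 0 i) ->
  (f x *m A) 0 i @[x --> F] --> (a *m A) 0 i.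
Proof.
move=> fa; under eq_fun do rewrite mxE; rewrite mxE.
by apply: cvg_sumr => j; apply: cvgMl.
Qed.

(** The norm of row vectors is the sup norm, so balls are cubes, while [dot] is Euclidean. This
    inequality links the two. *)
Lemma norm_sqr_le_dot n (v : 'rV[R]_n) : `|v| ^+ 2 <= dot v v.
Proof.
have [->|v0] := eqVneq v 0; first by rewrite normr0 expr0n dot_ge0.
have [[i j] vE] : exists ij, `|v| = `|v ij.1 ij.2|.
  by apply: mx_norm_neq0; rewrite -[mx_norm v]/(`|v|) normr_eq0.
by rewrite vE (ord1 i) real_normK ?num_real// sqr_coord_le_dot.
Qed.

Lemma sphere_compact n : compact [set v : 'rV[R]_n | dot v v = 1].
Proof.
apply: bounded_closed_compact.
  exists 1; split; first exact: num_real.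
  move=> M M1 v /= v1.
  apply: le_trans (ltW M1); rewrite -(@ler_pXn2r _ 2)// ?nnegrE// expr1n.
  by rewrite -v1 norm_sqr_le_dot.
apply: (@preimage_closed _ _ (fun v : 'rV[R]_n => dot v v) [set 1]).
  by move=> v _; apply: (@cvg_dot _ (nbhs v)) => i; exact: coord_continuous.
exact: closed_eq.
Qed.

(** Maximize the form on the unit sphere. At a maximizer v the semidefinite matrix l - A has zero
    form, so [psd_kernel] makes v an eigenvector without differentiating; l bounds all eigenvalues,
    so it is the supremum in [lambda_max]. *)
Lemma rayleigh n (A : 'M[R]_n.+1) : Sym A -> exists v : 'rV[R]_n.+1,
  [/\ dot v v = 1, v *m A = lambda_max A *: v &
      forall w, qform A w <= lambda_max A * dot w w].
Proof.
move=> sA.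
have [||v] := @compact_EVT_max _ _ (qform A) _ _ (@sphere_compact n.+1).
- exists (delta_mx 0 0); rewrite /= dotE (bigD1 0)//= !mxE !eqxx mulr1.
  by rewrite big1 ?addr0// => i i0; rewrite mxE (negbTE i0) andbF mul0r.
- apply: continuous_subspaceT => v.
  by apply: (@cvg_dot _ (nbhs v)) => i; [apply: cvg_mulmx => k|]; exact: coord_continuous.
rewrite inE /= => v1 vmax; set l := qform A v in vmax.
have lmax w : qform A w <= l * dot w w.
  have [->|w0] := eqVneq w 0; first by rewrite /qform mul0mx /dot !mul0mx mxE mulr0.
  have d0 : 0 < dot w w by exact: dot_gt0.
  have s2 := sqr_sqrtr (ltW d0); set s := Num.sqrt _ in s2.
  have s0 : s != 0 by rewrite sqrtr_eq0 -ltNge.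
  have := vmax (s^-1 *: w).
  rewrite inE /= /qform -scalemxAl !dotZl !dotZr !mulrA -expr2 exprVn s2.
  rewrite mulVf ?gt_eqF// => /(_ erefl).
  by rewrite ler_pdivrMl// mulrC.
have vA : v *m A = l *: v.
  apply/eqP; rewrite -subr_eq0 -opprB oppr_eq0 -mul_mx_scalar -mulmxBr; apply/eqP.
  have qE w : qform (l%:M - A) w = l * dot w w - qform A w.
    by rewrite /qform mulmxBr mul_mx_scalar dotDl dotNl dotZl.
  apply: psd_kernel.
  - by rewrite /Sym /= linearB /= tr_scalar_mx sA.
  - by move=> w; rewrite qE subr_ge0.
  - by rewrite qE v1 mulr1 subrr.
have v0 : v != 0.
  by apply: contra_eq_neq v1 => ->; rewrite /dot mul0mx mxE eq_sym oner_eq0.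
suff -> : lambda_max A = l by exists v.
have el : eigenvalue A l by apply/eigenvalueP; exists v.
have ub : ubound [set a | eigenvalue A a] l.
  move=> a /= /eigenvalueP[w wA w0].
  have := lmax w; by rewrite /qform wA dotZl ler_pM2r// dot_gt0.
apply/eqP; rewrite eq_le ge_sup//=; last by exists l.
by apply: sup_upper_bound => //; split; [exists l|exists l].
Qed.

(** Reflection in the hyperplane orthogonal to u - v, which exchanges two unit vectors; u = v is
    apart because the normal vanishes. *)
Lemma householder n (u v : 'rV[R]_n) : dot u u = 1 -> dot v v = 1 ->
  exists2 Q : 'M[R]_n, Q *m Q^T = 1%:M & u *m Q = v.
Proof.
move=> u1 v1; have [<-|uv] := eqVneq u v.
  by exists 1%:M; rewrite ?trmx1 mulmx1.
set d := u - v; set s := dot d d.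
have s0 : s != 0 by apply: contra_neq uv => /dot_eq0/subr0_eq.
have ds : d *m d^T = s%:M by rewrite [LHS]mx11_scalar.
pose P := d^T *m d; pose Q := 1%:M - (2 / s) *: P.
have PP : P *m P = s *: P.
  by rewrite /P mulmxA -(mulmxA d^T) ds mul_mx_scalar -scalemxAl.
have QT : Q^T = Q by rewrite /Q linearB /= trmx1 linearZ /= /P trmx_mul trmxK.
exists Q.
  rewrite QT /Q mulmxBl mul1mx mulmxBr mulmx1 -scalemxAr -scalemxAl PP.
  rewrite !scalerA (_ : 2 / s * (2 / s) * s = 2 / s + 2 / s); last by field.
  rewrite scalerDl; set X := _ *: P.
  have -> : X - (X + X) = - X by rewrite opprD addrA subrr sub0r.
  by rewrite opprK subrK.
rewrite /Q mulmxBr mulmx1 -scalemxAr /P mulmxA [u *m d^T]mx11_scalar -/(dot u d).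
rewrite mul_scalar_mx scalerA (_ : 2 / s * dot u d = 1).
  by rewrite scale1r /d opprB addrC subrK.
have sE : s = 2 - 2 * dot u v.
  rewrite /s /d !(dotDl, dotDr, dotNl, dotNr) u1 v1 (dotC v u); ring.
have -> : dot u d = s / 2 by rewrite sE /d dotDr dotNr u1; field.
by field.
Qed.

End LinearAlgebra.

(** * The polar cone of a Hessian under rotations *)

Section PolarCone.
Context {R : realType} {n : nat}.
Variable H : 'M[R]_n.
Implicit Types Z Q : 'M[R]_n.

(** Quantifying over all [Q] makes this a convex cone stable under conjugation, so averages of
    conjugates stay in it. *)
Definition rotation_polar Z :=
  forall Q, Q *m Q^T = 1%:M -> inner (Q *m Z *m Q^T) H <= 0.

Lemma rotation_polar0 : rotation_polar 0.
Proof. by move=> Q _; rewrite /inner mulmx0 !mul0mx mxtrace0. Qed.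

Lemma rotation_polarD Z Z' :
  rotation_polar Z -> rotation_polar Z' -> rotation_polar (Z + Z').
Proof.
move=> gZ gZ' Q Q1; rewrite /inner mulmxDr !mulmxDl mxtraceD.
by rewrite -oppr_ge0 opprD addr_ge0// oppr_ge0; [exact: gZ|exact: gZ'].
Qed.

Lemma rotation_polarZ a Z :
  0 <= a -> rotation_polar Z -> rotation_polar (a *: Z).
Proof.
move=> a0 gZ Q Q1; rewrite /inner -scalemxAr -!scalemxAl mxtraceZ.
by rewrite mulr_ge0_le0//; exact: gZ.
Qed.

Lemma rotation_polarJ P Z :
  P *m P^T = 1%:M -> rotation_polar Z -> rotation_polar (P *m Z *m P^T).
Proof.
move=> P1 gZ Q Q1; have := gZ (Q *m P); rewrite trmx_mul !mulmxA; apply.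
by rewrite -(mulmxA Q) P1 mulmx1.
Qed.

(* Averaging with the conjugate by a reflection in the k-th coordinate
   hyperplane removes the off-diagonal entries in row and column k. *)
Lemma rotation_polar_diag Z : rotation_polar Z ->
  rotation_polar (\matrix_(i, j) (Z i j *+ (i == j))).
Proof.
move=> gZ.
(* [off s] is [Z] once the coordinates in [s] are treated: an entry dies if some [k] in [s] equals
   exactly one of its indices. The full list leaves the diagonal. *)
pose off s := \matrix_(i, j)
  if has (fun k => (i == k) (+) (j == k)) s then 0 else Z i j.
suff goff s : rotation_polar (off s).
  rewrite (_ : \matrix_(_, _) _ = off (enum 'I_n)); first exact: goff.
  apply/matrixP => i j; rewrite !mxE.
  have [->|ij] := eqVneq i j; rewrite ?mulr1n ?mulr0n.
    by rewrite (eq_has (a2 := pred0)) ?has_pred0// => k; rewrite addbb.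
  rewrite (_ : has _ _ = true)//; apply/hasP; exists i; rewrite ?mem_enum//.
  by rewrite eqxx eq_sym (negbTE ij).
elim: s => [|k s IHs].
  by rewrite (_ : off [::] = Z)//; apply/matrixP => i j; rewrite !mxE.
pose D : 'M[R]_n := diag_mx (\row_i (-1) ^+ (i == k)).
have DT : D^T = D by rewrite tr_diag_mx.
have DD : D *m D^T = 1%:M.
  rewrite DT mulmx_diag -diag_const_mx; congr diag_mx; apply/rowP => i.
  by rewrite !mxE -exprD addnn -mul2n exprM sqrrN expr1n expr1n.
rewrite (_ : off _ = 2^-1 *: (off s + D *m off s *m D^T)).
  apply: rotation_polarZ; first by rewrite invr_ge0.
  by apply: rotation_polarD => //; exact: rotation_polarJ.
apply/matrixP => i j; rewrite DT mul_diag_mx mul_mx_diag !mxE /=.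
case: (has _ s); rewrite ?orbT ?orbF ?mulr0 ?mul0r ?addr0 ?mulr0//.
by case: (i == k); case: (j == k); rewrite /= ?expr0 ?expr1; field.
Qed.

End PolarCone.

(** * Averaging over the coordinate permutations that fix index 0 *)

Section Average.
Context {R : realType} {n : nat}.
Variable H : 'M[R]_n.+1.
Implicit Types Z Q : 'M[R]_n.+1.
Local Notation polar := (rotation_polar H).

(** The average keeps the entry at 0 and replaces the other diagonal entries by their mean (tr Z - Z
    0 0) / n; the statement is this matrix multiplied by n, which avoids the division. *)
Lemma rotation_polar_average Z : polar Z ->
  polar ((n%:R * Z 0 0 - (\tr Z - Z 0 0)) *: delta_mx 0 0
         + (\tr Z - Z 0 0) *: 1%:M).
Proof.
move=> /rotation_polar_diag; set D := \matrix_(i, j) _ => gD.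
have D_off i j : i != j -> D i j = 0 by move=> ij; rewrite mxE (negbTE ij).
have D_diag i : D i i = Z i i by rewrite mxE eqxx.
pose A := \matrix_(i, j) \sum_(s : 'S_n.+1 | s 0 == 0) D (s i) (s j).
have gA : polar A.
  rewrite (_ : A = \sum_(s : 'S_n.+1 | s 0 == 0)
      (perm_mx s *m D *m (perm_mx s)^T)).
    apply: (big_ind polar); [exact: rotation_polar0|exact: rotation_polarD|].
    move=> s _; apply: rotation_polarJ => //.
    by rewrite tr_perm_mx -perm_mxM mulgV perm_mx1.
  apply/matrixP => i j; rewrite mxE summxE; apply: eq_bigr => s _.
  rewrite -row_permE tr_perm_mx -[perm_mx _]mul1mx.
  by rewrite mulmxA mulmx1 -col_permE !mxE.
pose N := #|[pred s : 'S_n.+1 | s 0 == 0]|.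
have N0 : (0 < N)%N.
  by apply/card_gt0P; exists 1%g; rewrite inE perm1.
have A00 : A 0 0 = N%:R * Z 0 0.
  rewrite mxE (eq_bigr (fun _ => Z 0 0)) => [|s /eqP ->]; last exact: D_diag.
  by rewrite sumr_const mulr_natl.
have trA : \tr A = N%:R * \tr Z.
  rewrite /mxtrace (eq_bigr (fun i => \sum_(s : 'S_n.+1 | s 0 == 0) Z (s i) (s i))).
    rewrite exchange_big /= (eq_bigr (fun _ => \tr Z)) => [|s _].
      by rewrite sumr_const mulr_natl.
    by rewrite /mxtrace [RHS](reindex_inj (@perm_inj _ s)).
  by move=> i _; rewrite mxE; apply: eq_bigr => s _; exact: D_diag.
have A_off i j : i != j -> A i j = 0.
  move=> ij; rewrite mxE big1// => s _; apply: D_off.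
  by rewrite (inj_eq perm_inj).
(* Composing with the transposition of i and j permutes the summation range, since it fixes 0. *)
have A_diag i j : i != 0 -> j != 0 -> A i i = A j j.
  move=> i0 j0; rewrite !mxE (reindex_inj (mulgI (tperm i j))) /=.
  apply: eq_big => [s|s _]; last by rewrite permM tpermL.
  by rewrite permM tpermD// eq_sym.
have A_tr i : i != 0 -> n%:R * A i i = N%:R * (\tr Z - Z 0 0).
  move=> i0; rewrite mulrBr -trA -A00 /mxtrace (bigD1 0)//= addrAC subrr add0r.
  rewrite (eq_bigr (fun _ => A i i)) => [|j j0]; last exact: A_diag.
  rewrite sumr_const mulr_natl; congr (_ *+ _).
  by have := cardC1 (0 : 'I_n.+1); rewrite card_ord => ->.
clearbody A.
have N0' : N%:R != 0 :> R by rewrite pnatr_eq0 -lt0n.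
have := rotation_polarZ (ler0n R n) gA; move=> /(rotation_polarZ (a := N%:R^-1)).
rewrite invr_ge0 ler0n => /(_ isT); congr polar.
apply/matrixP => i j; rewrite !mxE.
have [->|ij] := eqVneq i j; last first.
  rewrite A_off// !mulr0 addr0; have [i0|] := eqVneq i 0; rewrite ?mulr0//.
  by have [j0|] := eqVneq j 0; rewrite ?mulr0//; rewrite i0 j0 eqxx in ij.
have [->|j0] := eqVneq j 0.
  by rewrite A00 !mulr1; field.
by rewrite A_tr// mulr0 add0r mulr1; field.
Qed.

End Average.

(** * From the body of the operator to the quadratic inequality *)

Section Aperture.
Context {R : realType} {n : nat}.
Implicit Types (F : 'M[R]_n.+1 -> R) (H Z Q X : 'M[R]_n.+1).

Lemma dot_delta m (q : 'rV[R]_m) i : dot (delta_mx 0 i) q = q 0 i.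
Proof.
rewrite dotE (bigD1 i)//= mxE !eqxx mul1r big1 ?addr0// => j ji.
by rewrite mxE (negbTE ji) andbF mul0r.
Qed.

Lemma qform_delta m (A : 'M[R]_m) i : qform A (delta_mx 0 i) = A i i.
Proof. by rewrite /qform dotC dot_delta -rowE mxE. Qed.

(** Homogeneous in [q], so that a gradient can be inserted without normalization, even where it
    vanishes. *)
Definition dominated c H :=
  forall q, c * dot q q * \tr H + (1 - c) * qform H q <= 0.

Lemma tr_conj Q Z : Q *m Q^T = 1%:M -> \tr (Q *m Z *m Q^T) = \tr Z.
Proof. by move=> Q1; rewrite mxtrace_mulC mulmxA (mulmx1C Q1) mul1mx. Qed.

Lemma qform_conj Q Z q : qform (Q *m Z *m Q^T) q = qform Z (q *m Q).
Proof. by rewrite /qform !mulmxA dot_mul trmxK. Qed.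

(** Rotating a top eigenvector of [Z] to the first basis vector puts l at entry 0 of the diagonal
    and keeps all diagonal entries in [0, l]; the trace then gives the bounds on alpha. Averaging
    and rotating the first basis vector to q / |q| gives the inequality up to the positive factor l
    n / |q|^2. *)
Lemma rotation_polar_dominated Z H : (0 < n)%N -> Sym Z ->
  (forall q, 0 <= qform Z q) -> Z != 0 -> rotation_polar H Z ->
  let alpha := \tr Z / lambda_max Z in
  1 <= alpha <= n.+1%:R /\ dominated ((alpha - 1) / n%:R) H.
Proof.
move=> n0 sZ psd Z0 gZ alpha.
have [v [v1 vZ vmax]] := rayleigh sZ.
pose l := lambda_max Z; rewrite -/l in vZ vmax.
have e1 : dot (delta_mx 0 0 : 'rV[R]_n.+1) (delta_mx 0 0) = 1.
  by rewrite dot_delta mxE !eqxx.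
have [P P1 eP] := householder e1 v1.
have l_ge0 : 0 <= l by rewrite -[l]mulr1 -v1 -dotZl -vZ; exact: psd.
(* If l were 0, the form of [Z] would vanish identically and every row of [Z] would be 0. *)
have l0 : 0 < l.
  rewrite lt_neqAle l_ge0 andbT; apply: contra_neq Z0 => l0.
  apply/row_matrixP => i; rewrite row0 rowE; apply: psd_kernel => //.
  by apply/eqP; rewrite eq_le psd andbT (le_trans (vmax _))// -l0 mul0r.
pose Y := P *m Z *m P^T.
have gY : rotation_polar H Y by exact: rotation_polarJ.
have trY : \tr Y = alpha * l by rewrite tr_conj// /alpha -/l mulfVK// gt_eqF.
have Yii i : 0 <= Y i i <= l.
  rewrite -qform_delta qform_conj psd /= (le_trans (vmax _))//.
  by rewrite dot_mul -mulmxA P1 mulmx1 dot_delta mxE !eqxx mulr1.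
have Y00 : Y 0 0 = l.
  by rewrite -qform_delta qform_conj eP /qform vZ dotZl v1 mulr1.
have nz : n%:R != 0 :> R by rewrite pnatr_eq0 -lt0n.
split.
  apply/andP; split; rewrite -(ler_pM2r l0) -trY.
    rewrite mul1r -Y00 /mxtrace (bigD1 0)//= lerDl.
    by apply: sumr_ge0 => i _; have /andP[] := Yii i.
  rewrite /mxtrace (le_trans (ler_sum _ (F := fun=> Y _ _) (G := fun=> l) _))//.
    by move=> i _; have /andP[] := Yii i.
  by rewrite sumr_const card_ord mulr_natl.
have := rotation_polar_average gY; rewrite trY Y00.
set W := _ + _ => gW q.
have [->|q0] := eqVneq q 0.
  by rewrite /qform mul0mx /dot !mul0mx mxE mulr0 mul0r mulr0 addr0.
have d0 : 0 < dot q q by exact: dot_gt0.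
have s2 := sqr_sqrtr (ltW d0); set s := Num.sqrt _ in s2.
have s0 : s != 0 by rewrite sqrtr_eq0 -ltNge.
pose w := s^-1 *: q.
have w1 : dot w w = 1.
  by rewrite /w dotZl dotZr mulrA -expr2 exprVn s2 mulVf// gt_eqF.
have [Q Q1 eQ] := householder e1 w1.
have := gW Q^T; rewrite trmxK (mulmx1C Q1) => /(_ erefl).
have -> : inner (Q^T *m W *m Q) H =
   (n%:R * l - (alpha * l - l)) * qform H w + (alpha * l - l) * \tr H.
  rewrite /inner /W mulmxDr !mulmxDl mxtraceD -!scalemxAr -!scalemxAl !mxtraceZ.
  rewrite mulmx1 (mulmx1C Q1) mul1mx; congr (_ * _ + _).
  rewrite (_ : Q^T *m delta_mx 0 0 *m Q = w^T *m w).
    by rewrite -mulmxA mxtrace_mulC /mxtrace big_ord1.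
  rewrite -eQ trmx_mul trmx_delta !mulmxA.
  by rewrite -(mulmxA _ (delta_mx _ _) (delta_mx _ _)) mul_delta_mx.
have -> : qform H w = qform H q / dot q q.
  by rewrite /qform /w -scalemxAl dotZl dotZr mulrA -expr2 exprVn s2 mulrC.
have -> : (n%:R * l - (alpha * l - l)) * (qform H q / dot q q)
    + (alpha * l - l) * \tr H = (l * n%:R / dot q q) *
  ((alpha - 1) / n%:R * dot q q * \tr H + (1 - (alpha - 1) / n%:R) * qform H q).
  by field; rewrite nz gt_eqF.
by rewrite pmulr_rle0// divr_gt0// mulr_gt0// ltr0n.
Qed.

(** An element [Z] of the body satisfies <Z, X> <= F X. By rotational invariance, <Q Z Q^T, H> = <Z,
    Q^T H Q> <= F H <= 0. *)
Lemma operator_dominated F alpha : (0 < n)%N ->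
  rotationally_invariant F -> sublinear F -> degenerate_elliptic F ->
  is_solution_cone_aperture (associated_body F) alpha ->
  1 <= alpha <= n.+1%:R /\
  forall H, Sym H -> F H <= 0 -> dominated ((alpha - 1) / n%:R) H.
Proof.
move=> n0 rotF [_ homF] ellF [[Z [KZ Z0] <-] _].
(* The default value of [xget] is empty; since the chosen set contains [Z], it is a genuine
   associated body. *)
have [_ _ _ Ksym maxF] : is_associated_body F (associated_body F).
  rewrite /associated_body in KZ *; case: xgetP KZ => // K -> //.
have sZ : Sym Z := Ksym _ KZ.
have leF X : Sym X -> inner Z X <= F X.
  by move=> sX; have [_] := maxF X sX; apply; exists Z.
have F0 : F 0 = 0.
  by have := homF 0 0 (trmx0 _ _ _) (lexx _); rewrite scale0r mul0r.
have psd q : 0 <= qform Z q.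
  (* Testing with X = - q^T q, which lies below 0 in the Loewner order, shows that [Z] is positive
     semidefinite. *)
  rewrite -oppr_le0; pose X := - (q^T *m q).
  have sX : Sym X by rewrite /Sym /= linearN /= trmx_mul trmxK.
  have -> : - qform Z q = inner Z X.
    by rewrite /inner /X mulmxN linearN /= mulmxA mxtrace_mulC mulmxA
      /mxtrace big_ord1.
  apply: le_trans (leF _ sX) _; rewrite -F0; apply: ellF => //.
    by rewrite /Sym /= trmx0.
  move=> xi; rewrite mulmx0 mul0mx /X mulmxN mulNmx [leLHS]mxE [leRHS]mxE oppr_le0.
  have -> : xi^T *m (q^T *m q) *m xi = (q *m xi)^T *m (q *m xi).
    by rewrite trmx_mul !mulmxA.
  by rewrite -{2}[q *m xi]trmxK -/(dot _ _) dot_ge0.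
have ge1 := fun H => @rotation_polar_dominated Z H n0 sZ psd.
have nzZ : Z != 0 by apply/eqP.
have polar H : Sym H -> F H <= 0 -> rotation_polar H Z.
  move=> sH FH Q Q1; have QT1 := mulmx1C Q1.
  have -> : inner (Q *m Z *m Q^T) H = inner Z (Q^T *m H *m Q).
    by rewrite /inner -!mulmxA mxtrace_mulC !mulmxA.
  apply: le_trans (leF _ _) _; first by rewrite /Sym /= !trmx_mul trmxK sH mulmxA.
  by have := rotF H Q^T sH; rewrite trmxK => ->.
split; last by move=> H sH FH; have [] := ge1 H nzZ (polar H sH FH).
have s0 : Sym (0 : 'M[R]_n.+1) by rewrite /Sym /= trmx0.
(* The bounds on alpha do not involve [H], so they are read off at H = 0. *)
by have [] := ge1 0 nzZ (polar 0 s0 _); rewrite ?F0.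
Qed.

(** Summing over the standard basis gives (1 + c n) tr H <= 0. *)
Lemma dominated_tr_le0 c H : 0 <= c <= 1 -> dominated c H -> \tr H <= 0.
Proof.
move=> /andP[c0 c1] dH.
have : \sum_i (c * \tr H + (1 - c) * H i i) <= 0.
  apply: sumr_le0 => i _; have := dH (delta_mx 0 i).
  by rewrite qform_delta dot_delta mxE !eqxx mulr1.
rewrite big_split /= sumr_const card_ord -mulr_sumr -/(mxtrace H).
have -> : (c * \tr H) *+ n.+1 + (1 - c) * \tr H = (1 + c * n%:R) * \tr H.
  by rewrite -mulr_natr -natr1; ring.
by rewrite pmulr_rle0// ltr_pwDl// mulr_ge0.
Qed.

Lemma dominated_lambda_max c H :
  Sym H -> dominated c H -> c * \tr H + (1 - c) * lambda_max H <= 0.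
Proof.
move=> sH dH; have [v [v1 vH _]] := rayleigh sH.
by have := dH v; rewrite /qform vH dotZl v1 !mulr1.
Qed.

End Aperture.

(** * Second derivatives of test functions *)

Section Calculus.
Context {R : realType}.

Lemma is_derive_line (V : normedModType R) (f : V -> R) (x v : V) (t : R) d :
  is_derive (t *: v + x) v f d <->
  is_derive t 1 (fun s : R => f (s *: v + x)) d.
Proof.
have E : (fun h : R => h^-1 *: ((f \o shift (t *: v + x)) (h *: v)
      - f (t *: v + x))) =
    (fun h : R => h^-1 *: (((fun s : R => f (s *: v + x)) \o shift t) (h *: 1)
      - f (t *: v + x))).
  by apply/funext => h /=; rewrite [h *: 1]mulr1 scalerDl addrA.
by split=> -[dd dv]; split; move: dd dv; rewrite /derivable /derive E.
Qed.

Lemma is_derive_line0 (V : normedModType R) (f : V -> R) (x v : V) d :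
  is_derive x v f d <-> is_derive (0 : R) 1 (fun s : R => f (s *: v + x)) d.
Proof. by rewrite -is_derive_line scale0r add0r. Qed.

(** Chain rule with [f] derivable only along v: on the line both functions have one real variable,
    where derivability is differentiability. *)
Lemma is_derive_comp1 (V : normedModType R) (f : V -> R) (x v : V)
    (psi : R -> R) d d' :
  is_derive (f x) 1 psi d' -> is_derive x v f d ->
  is_derive x v (psi \o f) (d' * d).
Proof.
move=> dpsi /is_derive_line0 df; apply/is_derive_line0.
set g := fun s : R => _ in df.
have dpsi' : is_derive (g 0) 1 psi d' by rewrite /g scale0r add0r.
have ex1 := @ex_derive _ _ _ _ _ _ _ df.
have ex2 := @ex_derive _ _ _ _ _ _ _ dpsi'.
split; last first.
  by rewrite -derive1E (derive1_comp ex1 ex2) !derive1E !derive_val.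
have /derivable1_diffP D1 := ex1; have /derivable1_diffP D2 := ex2.
exact/derivable1_diffP/(differentiable_comp D1 D2).
Qed.

End Calculus.

(** * Symmetry of mixed second partials *)

Section Schwarz.
Context {R : realType} {n : nat}.
Implicit Types (phi : 'rV[R]_n -> R) (x y : 'rV[R]_n).
Local Notation e i := (delta_mx 0 i : 'rV[R]_n).

Lemma norm_delta_le1 i : `|e i| <= 1.
Proof.
rewrite -(@ler_pXn2r _ 2)// ?nnegrE// expr1n.
by rewrite (le_trans (norm_sqr_le_dot _))// dot_delta mxE !eqxx.
Qed.

Lemma square_in_ball x r (h s t : R) i j : 0 <= s <= h -> 0 <= t <= h ->
  2 * h < r -> ball x r (s *: e i + (t *: e j + x)).
Proof.
move=> /andP[s0 sh] /andP[t0 th] hr; rewrite -ball_normE /ball_ /=.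
rewrite distrC addrA addrK (le_lt_trans (ler_normD _ _))//.
rewrite !normrZ !ger0_norm//; apply: le_lt_trans hr; rewrite mulr2n mulrDl !mul1r.
by apply: lerD; [rewrite -[h]mulr1|rewrite -[h]mulr1]; apply: ler_pM => //;
  exact: norm_delta_le1.
Qed.

(** The mean value theorem twice, first along [e i] and then along [e j]. The left side is symmetric
    in i and j, while the right side is not visibly so. *)
Lemma second_difference phi x r h i j : 0 < h -> 2 * h < r ->
  (forall y, ball x r y -> derivable phi y (e i) /\
    derivable (partial i phi) y (e j)) ->
  exists2 y, ball x r y &
    phi (h *: e i + (h *: e j + x)) - phi (h *: e i + x)
      - (phi (h *: e j + x) - phi x) =
    h ^+ 2 * partial j (partial i phi) y.
Proof.
move=> h0 hr dphi.
have inb s t : 0 <= s <= h -> 0 <= t <= h -> ball x r (s *: e i + (t *: e j + x)).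
  by move=> sh th; exact: square_in_ball sh th hr.
have h1 : 0 <= h <= h by apply/andP; split=> //; exact: ltW.
have h2 : 0 <= (0 : R) <= h by apply/andP; split=> //; exact: ltW.
have dline t : 0 <= t <= h -> forall s : R, s \in `[0, h]%R ->
    is_derive s 1 (fun s : R => phi (s *: e i + (t *: e j + x)))
      (partial i phi (s *: e i + (t *: e j + x))).
  move=> th s; rewrite in_itv /= => sh.
  apply: (is_derive_line phi (t *: e j + x) (e i) s _).1.
  by apply: derivableP; have [] := dphi _ (inb _ _ sh th).
pose g s := phi (s *: e i + (h *: e j + x)) - phi (s *: e i + (0 *: e j + x)).
pose g' s := partial i phi (s *: e i + (h *: e j + x))
  - partial i phi (s *: e i + (0 *: e j + x)).
have dg s : s \in `[0, h]%R -> is_derive s 1 g (g' s).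
  by move=> sh; apply: is_deriveB; exact: dline.
have dgoo s (sh : s \in `]0, h[%R) := dg s (subset_itv_oo_cc sh).
have cg : {within `[0, h], continuous g}.
  by apply: derivable_within_continuous => s sh; exact: (@ex_derive _ _ _ _ _ _ _ (dg s sh)).
have [s] := MVT h0 dgoo cg.
move=> /subset_itv_oo_cc sI; have := sI; rewrite in_itv /= => sh.
pose k t := partial i phi (t *: e j + (s *: e i + x)).
pose k' t := partial j (partial i phi) (t *: e j + (s *: e i + x)).
have dk t : t \in `[0, h]%R -> is_derive t 1 k (k' t).
  rewrite in_itv /= => th.
  apply: (is_derive_line (partial i phi) (s *: e i + x) (e j) t _).1.
  apply: derivableP.
  by rewrite addrCA; have [] := dphi _ (inb _ _ sh th).
have dkoo t (th : t \in `]0, h[%R) := dk t (subset_itv_oo_cc th).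
have ck : {within `[0, h], continuous k}.
  by apply: derivable_within_continuous => t th; exact: (@ex_derive _ _ _ _ _ _ _ (dk t th)).
have [t] := MVT h0 dkoo ck.
move=> /subset_itv_oo_cc; rewrite in_itv /= => th kE gE.
exists (s *: e i + (t *: e j + x)); first exact: inb.
move: gE; rewrite /g /g' !scale0r !add0r subr0 => ->.
have := kE; rewrite /k /k' !scale0r !add0r subr0 addrCA => ->.
by rewrite addrCA expr2 mulrC mulrA mulrAC.
Qed.

Lemma partial_comm phi x i j : C2_near phi x ->
  partial i (partial j phi) x = partial j (partial i phi) x.
Proof.
move=> C2; apply/eqP; rewrite -subr_eq0 -normr_le0; apply/ler_addgt0Pl => eps eps0.
have e2 : 0 < eps / 2 by rewrite divr_gt0.
have [_ _ /(_ _ _)C2x] := nbhs_singleton C2.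
have cij := (C2x j i).2; have cji := (C2x i j).2.
have nc1 : \forall y \near x,
    `|partial i (partial j phi) x - partial i (partial j phi) y| < eps / 2.
  exact: (@cvgr_dist_lt _ _ _ _ _ _ _ cij).
have nc2 : \forall y \near x,
    `|partial j (partial i phi) x - partial j (partial i phi) y| < eps / 2.
  exact: (@cvgr_dist_lt _ _ _ _ _ _ _ cji).
have nij : \forall y \near x, [/\ derivable phi y (e i),
    derivable (partial i phi) y (e j), derivable phi y (e j),
    derivable (partial j phi) y (e i) &
    `|partial i (partial j phi) x - partial i (partial j phi) y| < eps / 2 /\
    `|partial j (partial i phi) x - partial j (partial i phi) y| < eps / 2].
  apply: filterS3 C2 nc1 nc2 => y [_ d1 d2] p1 p2.
  split; [exact: (d1 i).1|exact: (d2 i j).1|exact: (d1 j).1|exact: (d2 j i).1|].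
  by split.
have [r /= r0 rP] : exists2 r, 0 < r & forall y, ball x r y ->
    [/\ derivable phi y (e i),
    derivable (partial i phi) y (e j), derivable phi y (e j),
    derivable (partial j phi) y (e i) &
    `|partial i (partial j phi) x - partial i (partial j phi) y| < eps / 2 /\
    `|partial j (partial i phi) x - partial j (partial i phi) y| < eps / 2].
  by case/nbhs_ballP: nij => r r0 rP; exists r.
pose h := r / 3.
have h0 : 0 < h by rewrite divr_gt0.
have hr : 2 * h < r by rewrite /h; lra.
have [|y1 by1 E1] := @second_difference phi x r h i j h0 hr.
  by move=> y /rP[].
have [|y2 by2 E2] := @second_difference phi x r h j i h0 hr.
  by move=> y /rP[].
(* Both orders compute the same second difference, so the two mixed partials agree at points within
   eps / 2 of their values at x. *)
have EE : partial j (partial i phi) y1 = partial i (partial j phi) y2.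
  apply: (@mulfI _ (h ^+ 2)); first by rewrite expf_neq0 ?gt_eqF.
  by rewrite -E1 -E2 addrCA; ring.
have [_ _ _ _ [_ P1]] := rP _ by1; have [_ _ _ _ [P2 _]] := rP _ by2.
rewrite -EE in P2; rewrite distrC in P1; rewrite addr0.
apply: ltW; rewrite (splitr eps); apply: le_lt_trans (ltrD P2 P1).
by rewrite (le_trans _ (ler_normD _ _))// addrA subrK.
Qed.

(** Needed because the conditions on the operator concern symmetric matrices only. *)
Lemma hessian_sym phi x : C2_near phi x -> Sym (hessian phi x).
Proof.
by move=> C2; rewrite /Sym /=; apply/matrixP => i j; rewrite !mxE; exact: partial_comm.
Qed.

Lemma laplacianE phi x : laplacian phi x = \tr (hessian phi x).
Proof. by apply: eq_bigr => i _; rewrite mxE. Qed.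

End Schwarz.

(** * Explicit C^2 test functions *)

Section TestFunctions.
Context {R : realType} {n : nat}.
Implicit Types (phi : 'rV[R]_n -> R) (x y : 'rV[R]_n) (U : set 'rV[R]_n).
Local Notation e i := (delta_mx 0 i : 'rV[R]_n).

Lemma near_eq_continuous (T S : topologicalType) (f g : T -> S) (x : T) :
  (\near x, f x = g x) -> {for x, continuous f} -> {for x, continuous g}.
Proof.
move=> fg cf; rewrite /prop_for /continuous_at -(nbhs_singleton fg).
by apply: cvg_trans cf; exact: near_eq_cvg.
Qed.

(** The formulas are required on an open set because [C2_near] speaks of all nearby points. The
    index order flips: [h i j] differentiates first in i, the entry i j of [hessian] first in j. *)
Lemma C2_open phi U x g h : open U -> U x ->
  (forall y, U y -> {for y, continuous phi}) ->
  (forall y, U y -> forall i : 'I_n, is_derive y (e i) phi (g i y) /\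
     {for y, continuous (g i)}) ->
  (forall y, U y -> forall i j : 'I_n, is_derive y (e j) (g i) (h i j y) /\
     {for y, continuous (h i j)}) ->
  C2_near phi x /\ hessian phi x = \matrix_(i, j) h j i x.
Proof.
move=> oU Ux cphi dphi dg.
have nU y : U y -> \forall z \near y, U z by move=> Uy; exact: open_nbhs_nbhs.
have gE i y : U y -> partial i phi y = g i y.
  by move=> Uy; have [d1 _] := dphi y Uy i; exact: (@derive_val _ _ _ _ _ _ _ d1).
have ngE i y : U y -> \near y, g i y = partial i phi y.
  by move=> Uy; apply: filterS (nU _ Uy) => z /gE ->.
have dpg i j y : U y -> is_derive y (e j) (partial i phi) (h i j y).
  move=> Uy; apply: near_eq_is_derive (ngE i y Uy) _.
  by have [] := dg y Uy i j.
have hE i j y : U y -> partial j (partial i phi) y = h i j y.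
  by move=> Uy; exact: (@derive_val _ _ _ _ _ _ _ (dpg i j y Uy)).
have nhE i j y : U y -> \near y, h i j y = partial j (partial i phi) y.
  by move=> Uy; apply: filterS (nU _ Uy) => z /hE ->.
split; last by apply/matrixP => i j; rewrite !mxE hE.
apply: filterS (nU _ Ux) => y Uy; split; first exact: cphi.
  move=> i; have [d1 c1] := dphi y Uy i; split.
    exact: (@ex_derive _ _ _ _ _ _ _ d1).
  exact: near_eq_continuous (ngE i y Uy) c1.
move=> i j; have [d1 c1] := dg y Uy i j; split.
  exact: (@ex_derive _ _ _ _ _ _ _ (dpg i j y Uy)).
exact: near_eq_continuous (nhE i j y Uy) c1.
Qed.

Definition quadratic (a : R) (b : 'rV[R]_n) (M : 'M[R]_n) x0 y : R :=
  a + dot b (y - x0) + qform M (y - x0).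

Definition quadratic_grad (b : 'rV[R]_n) (M : 'M[R]_n) x0 y : 'rV[R]_n :=
  b + 2 *: ((y - x0) *m M).

Lemma is_derive_affine_sqr (a b c : R) :
  is_derive (0 : R) 1 (fun s : R => a + s * b + s ^+ 2 * c) b.
Proof.
have d1 : is_derive (0 : R) 1 (fun s : R => s * b) b.
  apply: (is_derive_eq (is_deriveM (is_derive_id (0 : R) 1)
    (is_derive_cst b (0 : R) 1))).
  by rewrite /GRing.scale /=; ring.
have d2 : is_derive (0 : R) 1 (fun s : R => s ^+ 2 * c) 0.
  apply: (is_derive_eq (is_deriveM (is_deriveM (is_derive_id (0 : R) 1)
    (is_derive_id (0 : R) 1)) (is_derive_cst c (0 : R) 1))).
  by rewrite /GRing.scale /=; ring.
apply: (is_derive_eq (is_deriveD (is_deriveD (is_derive_cst a (0 : R) 1) d1) d2)).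
by rewrite add0r addr0.
Qed.

Lemma is_derive_quadratic a b M x0 y v : Sym M ->
  is_derive y v (quadratic a b M x0) (dot (quadratic_grad b M x0 y) v).
Proof.
move=> sM; apply/is_derive_line0.
have := is_derive_affine_sqr (quadratic a b M x0 y)
  (dot (quadratic_grad b M x0 y) v) (qform M v).
congr is_derive; apply/funext => s.
rewrite /quadratic /quadratic_grad.
rewrite (_ : s *: v + y - x0 = s *: v + (y - x0)); last by rewrite addrA.
move: (y - x0) => w; rewrite /qform mulmxDl -scalemxAl !(dotDl, dotDr, dotZl, dotZr).
rewrite (_ : dot (v *m M) w = dot (w *m M) v).
  by rewrite -addrA; ring.
by rewrite dot_mul (sM : M^T = M) dotC.
Qed.

Lemma is_derive_quadratic_grad b M x0 y i v :
  is_derive y v (fun z => quadratic_grad b M x0 z 0 i) (2 * (v *m M) 0 i).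
Proof.
apply/is_derive_line0.
have := is_derive_affine_sqr (quadratic_grad b M x0 y 0 i)
  (2 * (v *m M) 0 i) 0.
congr is_derive; apply/funext => s.
rewrite /quadratic_grad (_ : s *: v + y - x0 = s *: v + (y - x0)); last by rewrite addrA.
move: (y - x0) => w; rewrite mulr0 addr0 [(s *: v + w) *m M]mulmxDl -scalemxAl.
by move: (w *m M) (v *m M) => A B; rewrite !mxE; ring.
Qed.

Lemma cvg_coordB x0 y i : (z - x0) 0 i @[z --> y] --> (y - x0) 0 i.
Proof.
rewrite !mxE; under eq_fun do rewrite !mxE.
apply: (@cvgB _ _ _ (nbhs y)); last exact: cvg_cst.
exact: (@coord_continuous R 1 n 0 i y).
Qed.

Lemma continuous_quadratic a b M x0 : continuous (quadratic a b M x0).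
Proof.
move=> y; apply: (@cvgD _ _ _ (nbhs y)).
  apply: (@cvgD _ _ _ (nbhs y)); first exact: cvg_cst.
  by apply: (@cvg_dot _ _ (nbhs y)) => i; [exact: cvg_cst|exact: cvg_coordB].
apply: (@cvg_dot _ _ (nbhs y)) => i; last exact: cvg_coordB.
by apply: (@cvg_mulmx _ _ (nbhs y)) => k; exact: cvg_coordB.
Qed.

Lemma continuous_quadratic_grad b M x0 i :
  continuous (fun z => quadratic_grad b M x0 z 0 i).
Proof.
move=> y; have E z : quadratic_grad b M x0 z 0 i = b 0 i + 2 * ((z - x0) *m M) 0 i.
  by rewrite /quadratic_grad mxE [X in _ + X]mxE.
rewrite /prop_for /continuous_at E; under eq_fun do rewrite E.
apply: (@cvgD _ _ _ (nbhs y)); first exact: cvg_cst.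
apply: (@cvgMr _ _ (nbhs y)).
by apply: (@cvg_mulmx _ _ (nbhs y)) => k; exact: cvg_coordB.
Qed.

(** Common source of the barriers: psi = id gives quadratic functions, and psi t = - C t^g on t > 0
    gives powers of the distance away from their centre. *)
Lemma C2_comp_quadratic (I : set R) (psi psi1 psi2 : R -> R) a b M x0 x :
  open I -> (forall s, I s -> is_derive s 1 psi (psi1 s)) ->
  (forall s, I s -> is_derive s 1 psi1 (psi2 s)) ->
  (forall s, I s -> {for s, continuous psi2}) ->
  Sym M -> I (quadratic a b M x0 x) ->
  let G := quadratic_grad b M x0 x in
  C2_near (psi \o quadratic a b M x0) x /\
  hessian (psi \o quadratic a b M x0) x =
    psi2 (quadratic a b M x0 x) *: (G^T *m G)
    + (2 * psi1 (quadratic a b M x0 x)) *: M.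
Proof.
move=> oI dpsi dpsi1 cpsi2 sM Ix G.
set Q := quadratic a b M x0 in Ix *.
have cQ : continuous Q by exact: continuous_quadratic.
have cG i : continuous (fun z => quadratic_grad b M x0 z 0 i).
  exact: continuous_quadratic_grad.
have cder (f : R -> R) (s d : R) : is_derive s 1 f d -> {for s, continuous f}.
  move=> /(@ex_derive _ _ _ _ _ _ _) /derivable1_diffP.
  exact: differentiable_continuous.
have cpQ (f : R -> R) (y : 'rV[R]_n) : {for Q y, continuous f} -> {for y, continuous (f \o Q)}.
  by move=> cf; exact: (@continuous_comp _ _ _ Q f y (cQ y) cf).
have oU : open (Q @^-1` I) by apply: open_comp => // ? _; exact: cQ.
pose g i y := psi1 (Q y) * quadratic_grad b M x0 y 0 i.
pose h i j y := psi1 (Q y) * (2 * M j i)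
  + quadratic_grad b M x0 y 0 i * (psi2 (Q y) * quadratic_grad b M x0 y 0 j).
have dQ y j : is_derive y (e j) Q (quadratic_grad b M x0 y 0 j).
  have := is_derive_quadratic a b x0 y (e j) sM.
  by rewrite dotC dot_delta.
have [] := @C2_open (psi \o Q) (Q @^-1` I) x g h oU Ix.
- by move=> y Iy; apply: cpQ; exact: cder (dpsi _ Iy).
- move=> y Iy i; split.
    exact: (is_derive_comp1 (dpsi _ Iy) (dQ y i)).
  apply: (@cvgM _ _ (nbhs y)); last exact: cG.
  by apply: (cpQ psi1); exact: cder (dpsi1 _ Iy).
- move=> y Iy i j; split.
    have d1 : is_derive y (e j) (psi1 \o Q)
        (psi2 (Q y) * quadratic_grad b M x0 y 0 j).
      exact: (is_derive_comp1 (dpsi1 _ Iy) (dQ y j)).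
    have d2 := is_derive_quadratic_grad b M x0 y i (e j).
    apply: (is_derive_eq (is_deriveM d1 d2)).
    by rewrite -rowE [row _ _ _ _]mxE.
  apply: (@cvgD _ _ _ (nbhs y)).
    apply: (@cvgMl _ _ (nbhs y)).
    by apply: (cpQ psi1); exact: cder (dpsi1 _ Iy).
  apply: (@cvgM _ _ (nbhs y)); first exact: cG.
  apply: (@cvgM _ _ (nbhs y)); last exact: cG.
  by apply: (cpQ psi2); exact: cpsi2.
move=> C2 ->; split=> //; apply/matrixP => i j.
rewrite mxE [RHS]mxE [X in _ = X + _]mxE [X in _ = _ + X]mxE.
rewrite [(_ *m _) i j]mxE big_ord1 [_^T _ _]mxE /h -/G; ring.
Qed.

End TestFunctions.

(** * The p-Laplacian *)

(** Where [S] vanishes the power need not be derivable, as m may be below 1; there S y < eps^(1/m)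
    is used directly. *)
Lemma continuous_powR_comp (R : realType) (T : topologicalType) (S : T -> R) (m : R) (x : T) :
  0 < m -> (forall y, 0 <= S y) -> {for x, continuous S} ->
  {for x, continuous (fun y => S y `^ m)}.
Proof.
move=> m0 S0 cS; have [Sx|Sx] := eqVneq (S x) 0; last first.
  apply: (@continuous_comp _ _ _ S (fun s => s `^ m)) => //.
  have Sp : 0 < S x by rewrite lt_neqAle eq_sym Sx S0.
  have /(@ex_derive _ _ _ _ _ _ _) /derivable1_diffP := is_derive1_powR m Sp.
  exact: differentiable_continuous.
rewrite /prop_for /continuous_at Sx powR0 ?gt_eqF//.
apply/(@cvgrPdist_lt _ _ _ (nbhs x)) => eps eps0.
have e1 : 0 < eps `^ m^-1 by rewrite powR_gt0.
move/(@cvgrPdist_lt _ _ _ (nbhs x)) : cS => /(_ _ e1); apply: filterS => y.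
rewrite Sx !sub0r !normrN ger0_norm// => Sy.
rewrite ger0_norm ?powR_ge0// -[eps](powRr1 (ltW eps0)) -(mulVf (lt0r_neq0 m0)).
by rewrite (powRrM _ m^-1); apply: gt0_ltr_powR; rewrite // nnegrE ?powR_ge0.
Qed.

(** The difference quotient is f (x + h v) times that of [g], and the first factor tends to 0. This
    handles critical points, where |grad phi|^(p - 2) may fail to be derivable. *)
Lemma is_derive_mul_zero (R : realType) (V : normedModType R) (f g : V -> R) (x v : V) :
  {for x, continuous f} -> f x = 0 -> derivable g x v -> g x = 0 ->
  is_derive x v (fun y => f y * g y) 0.
Proof.
move=> cf fx dg gx.
suff H : (fun h : R => h^-1 *: (((fun y => f y * g y) \o shift x) (h *: v)
    - (f x * g x))) @ 0^' --> (0 : R).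
  by split; [apply/cvg_ex; exists 0|exact: cvg_lim].
rewrite (_ : (fun h : R => _) = (fun h : R => f (h *: v + x) *
    (h^-1 *: ((g \o shift x) (h *: v) - g x)))); last first.
  apply/funext => h /=; rewrite fx gx mul0r !subr0 /GRing.scale /=; ring.
have cl : (h *: v + x) @[h --> (0 : R)^'] --> x.
  suff : (h *: v + x) @[h --> (0 : R)] --> x.
    by apply: cvg_trans; apply: cvg_app; exact: nbhs_dnbhs.
  have : (h *: v + x) @[h --> (0 : R)] --> (0 : R) *: v + x.
    apply: (@cvgD _ _ _ (nbhs (0 : R))); last exact: cvg_cst.
    exact: scalel_continuous.
  by rewrite scale0r add0r.
have cfl : f (h *: v + x) @[h --> (0 : R)^'] --> f x.
  exact: (cvg_comp _ _ cl cf).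
rewrite fx in cfl.
have cgl : h^-1 *: ((g \o shift x) (h *: v) - g x) @[h --> (0 : R)^']
    --> ('D_v g x : R) by exact: dg.
by have := cvgM cfl cgl; rewrite mul0r; apply.
Qed.

Section PLaplacian.
Context {R : realType} {n : nat}.
Implicit Types (phi : 'rV[R]_n.+1 -> R) (x y : 'rV[R]_n.+1).
Local Notation e i := (delta_mx 0 i : 'rV[R]_n.+1).

Lemma euclidean_normE m (q : 'rV[R]_m) : euclidean_norm q = Num.sqrt (dot q q).
Proof. by rewrite /euclidean_norm dotE; congr Num.sqrt; apply: eq_bigr. Qed.

Lemma powR_euclidean_norm m (q : 'rV[R]_m) (r : R) :
  euclidean_norm q `^ r = dot q q `^ (r / 2).
Proof.
by rewrite euclidean_normE -powR12_sqrt ?dot_ge0// -powRrM mulrC.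
Qed.

Lemma continuous_sqr_grad phi x : C2_near phi x ->
  {for x, continuous (fun y => dot (grad phi y) (grad phi y))}.
Proof.
move=> /nbhs_singleton[_ d1 _].
by apply: (@cvg_dot _ _ (nbhs x)) => i; rewrite !mxE; under eq_fun do rewrite mxE;
  exact: (d1 i).2.
Qed.

Lemma is_derive_sqr_grad phi x i : C2_near phi x ->
  is_derive x (e i) (fun y => dot (grad phi y) (grad phi y))
    (2 * (grad phi x *m (hessian phi x)^T) 0 i).
Proof.
move=> /nbhs_singleton[_ _ d2].
rewrite (_ : (fun y => _) = \sum_k (partial k phi * partial k phi)); last first.
  by apply/funext => y; rewrite dotE fct_sumE; apply: eq_bigr => k _; rewrite mxE.
have dk k : is_derive x (e i) (partial k phi) (partial i (partial k phi) x).
  by apply: derivableP; exact: (d2 k i).1.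
apply: (is_derive_eq (is_derive_sum (fun k => is_deriveM (dk k) (dk k)))).
rewrite mxE mulr_sumr; apply: eq_bigr => k _; rewrite !mxE /GRing.scale /=; ring.
Qed.

(** Off critical points the p-Laplacian is |grad|^(r - 4) (|grad|^2 tr H + (r - 2) <H grad, grad>),
    and c times the bracket is the left side of [dominated] at q = grad. *)
Lemma p_laplacian_fin_le0 phi x (c r : R) : C2_near phi x ->
  0 < c <= 1 -> c * (r - 2) = 1 - c -> dominated c (hessian phi x) ->
  p_laplacian r%:E phi x <= 0.
Proof.
move=> C2 /andP[c0 c1] cr dH; set H := hessian phi x in dH.
have trH : \tr H <= 0 by apply: dominated_tr_le0 dH; rewrite c1 ltW.
have r2 : 0 <= r - 2 by rewrite -(pmulr_rge0 _ c0) cr subr_ge0.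
(* For r = 2 the weight is 1 even at critical points, so it does not vanish there as it does for r >
   2. *)
have [r20|r20] := eqVneq (r - 2) 0.
  rewrite /= (_ : \sum_i _ = \tr H)//; apply: eq_bigr => i _.
  rewrite r20 mxE; congr (partial i _ x); apply/funext => y.
  by rewrite powRr0 mul1r mxE.
set m := (r - 2) / 2.
have m0 : 0 < m by rewrite divr_gt0// lt_neqAle eq_sym r20.
pose S y := dot (grad phi y) (grad phi y).
have fE i : (fun y => euclidean_norm (grad phi y) `^ (r - 2) * grad phi y 0 i)
    = (fun y => S y `^ m * partial i phi y).
  by apply/funext => y; rewrite powR_euclidean_norm mxE.
have di i : is_derive x (e i) (partial i phi) (H i i).
  have [_ _ d2] := nbhs_singleton C2; rewrite mxE.
  by apply: derivableP; exact: (d2 i i).1.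
have [S0|S0] := eqVneq (S x) 0.
  rewrite /= big1// => i _; rewrite fE.
  have gi : partial i phi x = 0.
    by move: (dot_eq0 S0) => /rowP/(_ i); rewrite !mxE.
  apply: (@derive_val _ _ _ _ _ _ _ (is_derive_mul_zero _ _ _ _)) => //.
    apply: (continuous_powR_comp m0) => [y|]; first exact: dot_ge0.
    exact: continuous_sqr_grad.
  by rewrite S0 powR0 ?gt_eqF.
have Sp : 0 < S x by rewrite lt_neqAle dot_ge0 eq_sym S0.
have dfi i : partial i (fun y => S y `^ m * partial i phi y) x =
    S x `^ m * H i i + partial i phi x *
      (m * S x `^ (m - 1) * (2 * (grad phi x *m H^T) 0 i)).
  have dS := is_derive_comp1 (is_derive1_powR m Sp) (is_derive_sqr_grad i C2).
  exact: (@derive_val _ _ _ _ _ _ _ (is_deriveM dS (di i))).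
have E : p_laplacian r%:E phi x =
    S x `^ (m - 1) * (S x * \tr H + (r - 2) * qform H (grad phi x)).
  rewrite /= (eq_bigr _ (fun i _ => congr1 (fun f => partial i f x) (fE i))).
  rewrite (eq_bigr _ (fun i _ => dfi i)) big_split /= -mulr_sumr -/(mxtrace H).
  rewrite mulrDr mulrA; congr (_ * _ + _).
    by rewrite -[X in _ * X](powRr1 (ltW Sp)) -powRD ?subrK// gt_eqF.
  rewrite /qform dot_mul dotE mulrA mulr_sumr; apply: eq_bigr => i _.
  by rewrite [grad phi x 0 i]mxE /m; field.
rewrite E mulr_ge0_le0 ?powR_ge0//.
rewrite -(pmulr_rle0 _ c0) mulrDr !mulrA cr.
exact: dH.
Qed.

Lemma p_laplacian_pinfty_le0 phi x :
  dominated 0 (hessian phi x) -> p_laplacian +oo%E phi x <= 0.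
Proof.
move=> /(_ (grad phi x)); rewrite !mul0r add0r subr0 mul1r; exact.
Qed.

End PLaplacian.

(** * Comparison with test functions *)

Section Semicontinuity.
Context {R : realType}.

Lemma lower_semicontinuous_near (T : topologicalType) (A : set T)
    (u : T -> \bar R) x a : open A ->
  lower_semicontinuous (u : subspace A -> \bar R) -> A x ->
  (a%:E < u x)%E -> \forall y \near x, (a%:E < u y)%E.
Proof.
move=> oA lu Ax /lu[V Vx Va].
have nA : nbhs x A by exact: open_nbhs_nbhs.
have wV : \forall y \near x, A y -> V y.
  suff : within A (nbhs x) V by [].
  by rewrite nbhs_subspace_in.
by apply: filterS2 wV nA => y AV /AV /Va.
Qed.

(** The sublevel sets form a filter base on K. At a cluster point c, a smaller value f x is
    impossible: near c one has f > f x, yet the sublevel set of x meets every neighbourhood of c. *)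
Lemma compact_lsc_min (T : topologicalType) (K : set T) (f : T -> \bar R) :
  K !=set0 -> compact K -> (forall x, K x -> f x != -oo%E) ->
  (forall x a, K x -> (a%:E < f x)%E ->
    \forall y \near x, K y -> (a%:E < f y)%E) ->
  exists2 c, K c & forall x, K x -> (f c <= f x)%E.
Proof.
move=> [k Kk] cK fNy lf.
pose B t := [set x | K x /\ (f x <= f t)%E].
have FF : Filter (filter_from K B).
  apply: filter_from_filter; first by exists k.
  move=> i j Ki Kj; have [fij|/ltW fji] := leP (f i) (f j).
    by exists i => // x [Kx fxi]; split; split=> //; exact: le_trans fij.
  by exists j => // x [Kx fxj]; split; split=> //; exact: le_trans fji.
have PF : ProperFilter (filter_from K B).
  by apply: filter_from_proper => i Ki; exists i; split.
have [|c [Kc clc]] := cK _ PF.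
  by exists k => // x [].
exists c => // x Kx; rewrite leNgt; apply/negP => fxc.
have [r fx] : exists r, f x = r%:E.
  by move: (fNy x Kx) fxc; case: (f x) => [r _ _| _ |//]; [exists r|rewrite ltNge leey].
rewrite fx in fxc.
have [y [[Ky yx] Kfy]] := clc (B x) _ (ex_intro2 _ _ x Kx (fun _ P => P)) (lf c r Kc fxc).
by have := Kfy Ky; rewrite ltNge -fx yx.
Qed.

Lemma compact_ball_le n (y : 'rV[R]_n) r : compact [set z | `|z - y| <= r].
Proof.
apply: bounded_closed_compact.
  exists (r + `|y|); split; first exact: num_real.
  move=> M M1 v /= vy; apply: le_trans (ltW M1).
  by rewrite -[v](subrK y) (le_trans (ler_normD _ _))// lerD2r.
apply: (@preimage_closed _ _ (fun z : 'rV[R]_n => `|z - y|) [set x | x <= r]).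
  move=> z _; apply: (@cvg_norm _ _ _ (nbhs z)).
  by apply: (@cvgB _ _ _ (nbhs z)); [exact: cvg_id|exact: cvg_cst].
exact: closed_le.
Qed.

Lemma open_ball_le_sub n (U : set 'rV[R]_n) x : open U -> U x ->
  exists2 r, 0 < r & [set z | `|z - x| <= r] `<=` U.
Proof.
move=> oU Ux; have /nbhs_ballP[r /= r0 rU] : nbhs x U by exact: open_nbhs_nbhs.
exists (r / 2); first by rewrite divr_gt0.
move=> z /= zx; apply: rU; rewrite -ball_normE /ball_ /= distrC.
by apply: le_lt_trans zx _; rewrite ltr_pdivrMr// ltr_pMr// ltr1n.
Qed.

End Semicontinuity.

Section Comparison.
Context {R : realType} {n : nat}.
Implicit Types (phi : 'rV[R]_n.+1 -> R) (x y : 'rV[R]_n.+1).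
Variables (Omega : set 'rV[R]_n.+1) (u : 'rV[R]_n.+1 -> \bar R) (c : R).

(* [viscosity_supersolution L] only tests the sign of [L], so the condition on
   Hessians is encoded by an operator with values 0 and 1. *)
Definition dominated_supersolution :=
  viscosity_supersolution (fun phi x =>
    if `[< dominated c (hessian phi x) >] then 0 else 1) Omega u.

Lemma growth_rate_addc phi (d : R) y v :
  (fun h : R => h^-1 *: (((fun z => phi z + d) \o shift y) (h *: v) - (phi y + d)))
  = (fun h : R => h^-1 *: ((phi \o shift y) (h *: v) - phi y)).
Proof. by apply/funext => h /=; rewrite opprD addrACA subrr addr0. Qed.

Lemma partial_addc i phi (d : R) : partial i (fun z => phi z + d) = partial i phi.
Proof.
apply/funext => y; rewrite /partial /derive.
by rewrite growth_rate_addc.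
Qed.

Lemma C2_near_addc phi (d : R) x : C2_near phi x -> C2_near (fun z => phi z + d) x.
Proof.
apply: filterS => y [cphi d1 d2]; split.
- by apply: (@cvgD _ _ _ (nbhs y)); [exact: cphi|exact: cvg_cst].
- move=> i; have -> := partial_addc i phi d.
  have [dphi cdphi] := d1 i; split; last exact: cdphi.
  by move: dphi; rewrite /derivable growth_rate_addc.
- move=> i j; have -> := partial_addc i phi d; exact: d2.
Qed.

Lemma hessian_addc phi (d : R) x : hessian (fun z => phi z + d) x = hessian phi x.
Proof.
have E : (fun j => partial j (fun z => phi z + d)) = (fun j => partial j phi).
  by apply/funext => j; exact: partial_addc.
exact: (congr1 (fun p => \matrix_(i, j) partial i (p j) x) E).
Qed.

Hypotheses (oOmega : open Omega) (su : dominated_supersolution).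

Lemma supersolution_dominated phi x : Omega x -> C2_near phi x ->
  u x = (phi x)%:E -> (\forall y \near x, ((phi y)%:E <= u y)%E) ->
  dominated c (hessian phi x).
Proof.
move=> Ox C2 ux nx; have [_ _ _ /(_ _ _ Ox C2 ux nx)] := su.
by case: asboolP => //; rewrite ler10.
Qed.

(** At a negative minimum z of u - phi over K, the first alternative fails and u z is finite; so z
    is interior and phi shifted by u z - phi z touches u from below, which forces the excluded
    inequality. *)
Lemma comparison (K : set 'rV[R]_n.+1) phi : compact K -> K `<=` Omega ->
  continuous phi ->
  (forall x, K x -> ((phi x)%:E <= u x)%E \/
     [/\ nbhs x K, C2_near phi x & ~ dominated c (hessian phi x)]) ->
  forall x, K x -> ((phi x)%:E <= u x)%E.
Proof.
move=> cK KO cphi H x Kx.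
have [uNy lu _ _] := su.
pose f z := (u z - (phi z)%:E)%E.
have fE z a : (a%:E < f z)%E = ((a + phi z)%:E < u z)%E.
  by rewrite /f lteBrDr// -EFinD.
have [|||z Kz zmin] := @compact_lsc_min R _ K f _ cK.
- by exists x.
- by move=> z /KO/uNy; rewrite /f; case: (u z).
- move=> z a Kz; rewrite fE => az.
  have [b ab bz] : exists2 b, a + phi z < b & (b%:E < u z)%E.
    move: az; case: (u z) => [r|_|//].
      rewrite lte_fin => azr; exists ((a + phi z + r) / 2); last rewrite lte_fin; lra.
    by exists (a + phi z + 1); rewrite ?ltry// ltrDl.
  have n1 := lower_semicontinuous_near oOmega lu (KO _ Kz) bz.
  have n2 : \forall y \near z, phi y < b - a.
    by apply: (cvgr_lt (phi z) (cphi z)); rewrite ltrBDl.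
  apply: filterS2 n1 n2 => y by' phiy _; rewrite fE (le_lt_trans _ by')// lee_fin.
  lra.
have [f0|f0] := leP 0%E (f z).
  have := le_trans f0 (zmin x Kx).
  by rewrite /f leeBrDr// add0e.
have [v uz] : exists v, u z = v%:E.
  move: (uNy z (KO _ Kz)) f0; rewrite /f.
  by case: (u z) => [r _ _| |]//; exists r.
have [uz'|[nK C2 nd]] := H z Kz.
  by move: f0; rewrite /f ltNge leeBrDr// add0e uz'.
exfalso; apply: nd; rewrite -(hessian_addc _ (v - phi z)).
apply: supersolution_dominated; [exact: KO|exact: C2_near_addc| |].
  by rewrite uz addrC subrK.
apply: filterS nK => y Ky.
have := zmin y Ky; rewrite /f uz -EFinB leeBrDr// -EFinD.
by rewrite addrC.
Qed.

End Comparison.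

(** * Continuity *)

Section Continuity.
Context {R : realType} {n : nat}.
Implicit Types (phi : 'rV[R]_n.+1 -> R) (x y : 'rV[R]_n.+1).
Variables (Omega : set 'rV[R]_n.+1) (u : 'rV[R]_n.+1 -> \bar R) (c : R).
Hypotheses (oOmega : open Omega) (su : dominated_supersolution Omega u c).

Lemma quadratic_dot x0 z : quadratic 0 0 1%:M x0 z = dot (z - x0) (z - x0).
Proof. by rewrite /quadratic /qform mulmx1 {1}/dot mul0mx mxE !add0r. Qed.

Lemma continuous_dotB x0 : continuous (fun z : 'rV[R]_n.+1 => dot (z - x0) (z - x0)).
Proof.
by move=> z; apply: (@cvg_dot _ _ (nbhs z)) => i; exact: cvg_coordB.
Qed.

Lemma continuous_power (g : R) x0 : 0 < g ->
  continuous (fun z : 'rV[R]_n.+1 => dot (z - x0) (z - x0) `^ g).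
Proof.
move=> g0 w; have S0 (v : 'rV[R]_n.+1) : 0 <= dot (v - x0) (v - x0) := dot_ge0 _.
exact: (continuous_powR_comp g0 S0 (@continuous_dotB x0 w)).
Qed.

(* The Hessian of z |-> - C |z - x0|^(2g) has a positive eigenvalue in the
   radial direction which dominates the trace as soon as 2g < 1 - c n. *)
Lemma power_barrier (C g : R) x0 x : 0 < C -> 0 < g -> 2 * g < 1 - c * n%:R ->
  x != x0 ->
  C2_near (fun z => - C * dot (z - x0) (z - x0) `^ g) x /\
  ~ dominated c (hessian (fun z => - C * dot (z - x0) (z - x0) `^ g) x).
Proof.
move=> C0 g0 gc xx0.
set d := x - x0; have d0 : d != 0 by rewrite subr_eq0.
pose s := dot d d.
have s0 : 0 < s by exact: dot_gt0.
pose psi t : R := - C * t `^ g.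
pose psi1 t : R := - C * (g * t `^ (g - 1)).
pose psi2 t : R := - C * (g * ((g - 1) * t `^ (g - 1 - 1))).
have dpow (k t m : R) : 0 < t ->
    is_derive t 1 (fun t => k * t `^ m) (k * (m * t `^ (m - 1))).
  by move=> t0; apply: is_deriveZ; exact: is_derive1_powR.
have E : (fun z => - C * dot (z - x0) (z - x0) `^ g) = psi \o quadratic 0 0 1%:M x0.
  by apply/funext => z; rewrite /psi /= quadratic_dot.
have QE : quadratic 0 0 1%:M x0 x = s by rewrite quadratic_dot.
have d1 (t : R) : 0 < t -> is_derive t 1 psi (psi1 t).
  by move=> t0; exact: dpow.
have d2 (t : R) : 0 < t -> is_derive t 1 psi1 (psi2 t).
  move=> /= t0; have := dpow (- C * g) t (g - 1) t0; rewrite /psi2 -mulrA.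
  by congr is_derive; apply/funext => z; rewrite /psi1 mulrA.
have c2 (t : R) : 0 < t -> {for t, continuous psi2}.
  move=> /= t0; have := dpow (- C * g * (g - 1)) t (g - 1 - 1) t0.
  move=> /(@ex_derive _ _ _ _ _ _ _) /derivable1_diffP /differentiable_continuous.
  rewrite (_ : psi2 = fun t => - C * g * (g - 1) * t `^ (g - 1 - 1))//.
  by apply/funext => z; rewrite /psi2 !mulrA.
have s1 : Sym (1%:M : 'M[R]_n.+1) by rewrite /Sym /= trmx1.
have Ix : [set t : R | 0 < t] (quadratic 0 0 1%:M x0 x) by rewrite /= QE.
have [C2 HE] := C2_comp_quadratic (@open_gt R 0) d1 d2 c2 s1 Ix.
rewrite E; split=> // /(_ d); rewrite HE QE.
rewrite (_ : quadratic_grad 0 1%:M x0 x = 2 *: d); last first.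
  by rewrite /quadratic_grad add0r mulmx1.
have qE : qform (psi2 s *: ((2 *: d)^T *m (2 *: d)) + (2 * psi1 s) *: 1%:M) d =
    4 * psi2 s * s ^+ 2 + 2 * psi1 s * s.
  rewrite /qform mulmxDr -!scalemxAr mulmx1 !mulmxA dotDl !dotZl.
  rewrite [d *m _]mx11_scalar -/(dot d (2 *: d)) dotZr mul_scalar_mx !dotZl.
  by rewrite -/s; ring.
have tE : \tr (psi2 s *: ((2 *: d)^T *m (2 *: d)) + (2 * psi1 s) *: 1%:M) =
    4 * psi2 s * s + 2 * psi1 s * n.+1%:R.
  rewrite mxtraceD !mxtraceZ mxtrace1 mxtrace_mulC /mxtrace big_ord1.
  by rewrite -/(dot (2 *: d) (2 *: d)) dotZl dotZr -/s; ring.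
rewrite qE tE -/s; apply/negP; rewrite -ltNge.
pose P := s `^ g.
have P0 : 0 < P by exact: powR_gt0.
have pw a : s `^ (a - 1) * s = s `^ a.
  rewrite -[X in _ * X](powRr1 (ltW s0)) -powRD ?subrK//.
  by rewrite (gt_eqF s0) implybT.
have p1 : s `^ (g - 1) * s = P by exact: pw.
have p2 : s `^ (g - 1 - 1) * s ^+ 2 = P by rewrite expr2 mulrA !pw.
(* The radial second derivative contributes 1 - 2g, and each of the n tangential ones costs c. *)
have -> : c * s * (4 * psi2 s * s + 2 * psi1 s * n.+1%:R) +
    (1 - c) * (4 * psi2 s * s ^+ 2 + 2 * psi1 s * s) =
  2 * C * g * (1 - c * n%:R - 2 * g) * P.
  have -> : 4 * psi2 s * s ^+ 2 = - 4 * C * g * (g - 1) * P.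
    by rewrite -p2 /psi2; ring.
  have -> : c * s * (4 * psi2 s * s + 2 * psi1 s * n.+1%:R) =
      c * (- 4 * C * g * (g - 1) * P - 2 * C * g * P * n.+1%:R).
    by rewrite -{1}p2 -p1 /psi2 /psi1; ring.
  have -> : 2 * psi1 s * s = - 2 * C * g * P by rewrite -p1 /psi1; ring.
  by rewrite -natr1; ring.
by rewrite !mulr_gt0// subr_gt0.
Qed.

Lemma supersolution_lower_bound y r : [set z | `|z - y| <= r] `<=` Omega ->
  0 <= r -> exists m : R, forall z, `|z - y| <= r -> (m%:E < u z)%E.
Proof.
move=> KO r0; have [uNy lu _ _] := su.
have [|||z Kz zmin] := @compact_lsc_min R _ _ u _ (@compact_ball_le R n.+1 y r).
- by exists y; rewrite /= subrr normr0.
- by move=> z /KO/uNy.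
- move=> z a /KO Oz az.
  by apply: filterS (lower_semicontinuous_near oOmega lu Oz az) => w.
have [m mz] : exists m : R, (m%:E < u z)%E.
  move: (uNy z (KO _ Kz)); case: (u z) => [v| |]// _.
    by exists (v - 1); rewrite lte_fin; lra.
  by exists 0; rewrite ltry.
by exists m => w Kw; apply: lt_le_trans mz (zmin _ Kw).
Qed.

(** The barrier has height A at the centre and is at most m on the boundary of the cube, where the
    Euclidean distance is at least r. Keeping A free below u y also covers u y = +oo. *)
Lemma supersolution_power_bound (g A m r : R) y z :
  0 < g -> 2 * g < 1 - c * n%:R -> 0 < r ->
  [set z | `|z - y| <= r] `<=` Omega ->
  (forall z, `|z - y| <= r -> (m%:E < u z)%E) ->
  m < A -> (A%:E <= u y)%E -> `|z - y| <= r ->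
  ((A - (A - m) * (dot (z - y) (z - y) `^ g / (r ^+ 2) `^ g))%:E <= u z)%E.
Proof.
move=> g0 gc r0 KO um mA uA zr.
pose C := (A - m) / (r ^+ 2) `^ g.
have rg0 : 0 < (r ^+ 2) `^ g by rewrite powR_gt0// exprn_gt0.
have C0 : 0 < C by rewrite divr_gt0// subr_gt0.
pose phi z := - C * dot (z - y) (z - y) `^ g + A.
have -> : A - (A - m) * (dot (z - y) (z - y) `^ g / (r ^+ 2) `^ g) = phi z.
  by rewrite /phi /C; field; rewrite gt_eqF.
apply: (comparison oOmega su (@compact_ball_le R n.+1 y r) KO) => //.
  move=> w; apply: (@cvgD _ _ _ (nbhs w)); last exact: cvg_cst.
  apply: (@cvgMr _ _ (nbhs w)); exact: (@continuous_power g y g0 w).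
move=> w /= wr; have [->|wy] := eqVneq w y.
  left; rewrite /phi subrr /dot mul0mx mxE powR0 ?gt_eqF// mulr0 add0r.
  exact: uA.
have [rw|wr'] := leP r `|w - y|.
  left; apply: le_trans (ltW (um w wr)); rewrite lee_fin /phi.
  have : (r ^+ 2) `^ g <= dot (w - y) (w - y) `^ g.
    apply: (ge0_ler_powR (ltW g0)).
    - by rewrite nnegrE sqr_ge0.
    - by rewrite nnegrE dot_ge0.
    - apply: le_trans (norm_sqr_le_dot _).
      by rewrite ler_pXn2r ?nnegrE ?normr_ge0 ?(ltW r0).
  move=> /(ler_wpM2l (ltW C0)); rewrite {1}/C divfK ?gt_eqF//; lra.
right; have [C2 nd] := power_barrier C0 g0 gc wy.
split; [|exact: C2_near_addc|by rewrite hessian_addc].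
apply/nbhs_ballP; exists (r - `|w - y|); first by rewrite /= subr_gt0.
move=> v; rewrite -ball_normE /ball_ /= distrC ltrBrDr => vw; apply: ltW.
by apply: le_lt_trans vw; rewrite -{1}(subrK w v) -addrA ler_normD.
Qed.

Hypothesis cn : c * n%:R < 1.
Let g : R := (1 - c * n%:R) / 4.
Let g0 : 0 < g. Proof. by rewrite divr_gt0// subr_gt0. Qed.
Let gc : 2 * g < 1 - c * n%:R. Proof. by move: cn; rewrite /g; lra. Qed.

Lemma near_power_ratio y (r eps : R) : 0 < r -> 0 < eps ->
  \forall z \near y, dot (z - y) (z - y) `^ g / (r ^+ 2) `^ g < eps.
Proof.
move=> r0 eps0.
have rg0 : 0 < (r ^+ 2) `^ g by rewrite powR_gt0// exprn_gt0.
have cS := @continuous_power g y g0 y.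
have z0 : dot (y - y) (y - y) `^ g = 0.
  by rewrite subrr /dot mul0mx mxE powR0 ?gt_eqF.
rewrite /continuous_at z0 in cS.
have : \forall z \near y, dot (z - y) (z - y) `^ g < eps * (r ^+ 2) `^ g.
  by apply: (cvgr_lt 0 cS); exact: mulr_gt0.
by apply: filterS => z; rewrite ltr_pdivrMr.
Qed.

(** If u x = +oo, the barrier at x has arbitrary height A. At a point z of finiteness where the
    power ratio is below 1/2, it gives u z >= (A + m) / 2, absurd for large A. *)
Lemma supersolution_fin x : Omega x -> u x \is a fin_num.
Proof.
move=> Ox; have [uNy lu dense _] := su.
rewrite fin_numE uNy//=; apply/negP => /eqP ux.
have [r r0 KO] := open_ball_le_sub oOmega Ox.
have [m um] := supersolution_lower_bound KO (ltW r0).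
have half0 : 0 < 2^-1 :> R by rewrite invr_gt0.
have n1 := near_power_ratio x r0 half0.
have n2 : \forall z \near x, `|z - x| <= r.
  apply/nbhs_ballP; exists r => // z.
  by rewrite -ball_normE /ball_ /= distrC => /ltW.
have [z [[Oz fz] [tz zr]]] := dense x Ox _ (filterI n1 n2).
set t := _ / _ in tz.
have t0 : 0 <= t by rewrite divr_ge0// powR_ge0.
pose v := fine (u z).
pose A := 2 * `|v| + 2 * `|m| + 1.
have := supersolution_power_bound g0 gc r0 KO um (A := A) _ _ zr.
rewrite ux leey -(fineK fz) lee_fin -/v -/t => /(_ _ isT).
have v1 := ler_norm v; have v2 := normr_ge0 v.
have m1 := ler_norm m; have m2 := normr_ge0 m.
have m3 : - m <= `|m| by rewrite -normrN ler_norm.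
have mA : m < A by rewrite /A; lra.
move=> /(_ mA); apply/negP; rewrite -ltNge.
have : (A - m) * t <= (A - m) * 2^-1 by rewrite ler_pM2l ?subr_gt0// ltW.
rewrite /A; lra.
Qed.

(** For upper semicontinuity, suppose u z >= v + eps with z near x. The barrier is centred at z, on
    a cube of radius r / 2 so that the same m serves, and evaluated at x: a power ratio below eps /
    (v + eps - m) gives u x > v. *)
Lemma supersolution_continuous : continuous_in Omega u.
Proof.
split; first exact: supersolution_fin.
rewrite continuous_open_subspace// => x; rewrite inE => Ox.
have [uNy lu dense _] := su.
have nO : \forall z \near x, Omega z by exact: open_nbhs_nbhs.
rewrite /continuous_at -(fineK (supersolution_fin Ox)).
apply/(@fine_cvgP _ _ (nbhs x)); split.
  by apply: filterS nO => z; exact: supersolution_fin.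
have [r r0 KO] := open_ball_le_sub oOmega Ox.
have [m um] := supersolution_lower_bound KO (ltW r0).
apply/(@cvgrPdist_lt _ _ _ (nbhs x)) => eps eps0.
set v := fine (u x).
have ux : u x = v%:E by rewrite /v fineK// supersolution_fin.
have n1 : \forall z \near x, ((v - eps)%:E < u z)%E.
  by apply: (lower_semicontinuous_near oOmega lu Ox); rewrite ux lte_fin ltrBlDr ltrDl.
have mv : m < v by rewrite -lte_fin -ux um// subrr normr0 ltW.
have r20 : 0 < r / 2 by rewrite divr_gt0.
have e20 : 0 < eps / (v + eps - m) by rewrite divr_gt0//; lra.
have n2 := near_power_ratio x r20 e20.
have n3 : \forall z \near x, `|z - x| <= r / 2.
  apply/nbhs_ballP; exists (r / 2) => // z.
  by rewrite -ball_normE /ball_ /= distrC => /ltW.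
apply: filterS3 (filterI n1 nO) n2 n3 => z [vz Oz] tz zr /=.
have uz : u z = (fine (u z))%:E by rewrite fineK// supersolution_fin.
set w := fine (u z) in uz *.
rewrite uz lte_fin in vz.
rewrite ltr_norml; apply/andP; split; last by lra.
rewrite ltNge; apply/negP => wge.
have zKO : [set y | `|y - z| <= r / 2] `<=` [set y | `|y - x| <= r].
  move=> y /= yz; rewrite (splitr r); apply: le_trans (lerD yz zr).
  by rewrite -{1}(subrK z y) -addrA ler_normD.
have := supersolution_power_bound g0 gc r20 (subset_trans zKO KO)
  (fun y yz => um y (zKO y yz)) (A := v + eps) (z := x).
rewrite uz ux !lee_fin distrC.
have -> : dot (x - z) (x - z) = dot (z - x) (z - x).
  by rewrite -opprB dotNl dotNr opprK.
set t := _ / _ in tz *.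
have mA : m < v + eps by lra.
have wge' : v + eps <= w by lra.
move=> /(_ mA wge' zr).
move: tz; rewrite ltr_pdivlMr ?subr_gt0// => tz.
lra.
Qed.

End Continuity.

(** * Concavity *)

Section Concavity.
Context {R : realType} {n : nat}.
Implicit Types (x y z : 'rV[R]_n.+1).
Variables (Omega : set 'rV[R]_n.+1) (u : 'rV[R]_n.+1 -> \bar R).
Hypotheses (oOmega : open Omega) (su : dominated_supersolution Omega u 0).

Lemma hessian_quadratic a b (M : 'M[R]_n.+1) x0 x : Sym M ->
  C2_near (quadratic a b M x0) x /\ hessian (quadratic a b M x0) x = 2 *: M.
Proof.
move=> sM.
have d1 (s : R) : setT s -> is_derive s 1 id (cst 1 s).
  by move=> _; exact: is_derive_id.
have d2 (s : R) : setT s -> is_derive s 1 (cst (1 : R)) (cst 0 s).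
  by move=> _; exact: is_derive_cst.
have c2 (s : R) : setT s -> {for s, continuous (cst (0 : R))}.
  by move=> _; exact: cst_continuous.
have [C2 H] := C2_comp_quadratic (@openT R) d1 d2 c2 sM (I : setT (quadratic a b M x0 x)).
split; first exact: C2.
by rewrite -[quadratic _ _ _ _]/(id \o quadratic a b M x0) H scale0r add0r mulr1.
Qed.

(* Comparison on the slab of the ball between the hyperplanes through x and y
   orthogonal to the segment, with a quadratic function which is slightly
   convex along the segment and very concave across it. *)
Lemma supersolution_concave x0 (rho vx vy t : R) x y :
  [set z | `|z - x0| <= rho] `<=` Omega ->
  `|x - x0| <= rho / 2 -> `|y - x0| <= rho / 2 -> x != y ->
  u x = vx%:E -> u y = vy%:E -> 0 <= t <= 1 ->
  ((t * vx + (1 - t) * vy)%:E <= u (t *: x + (1 - t) *: y))%E.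
Proof.
move=> KO xr yr xy ux uy /andP[t0 t1].
have [uNy lu _ _] := su.
have rho0 : 0 <= rho by have := normr_ge0 (x - x0); lra.
have ball_xy w : `|w - x0| <= rho / 2 -> `|w - x0| <= rho by lra.
have Ox : Omega x by apply: KO; exact: ball_xy.
have Oy : Omega y by apply: KO; exact: ball_xy.
(* One eta is spent on lowering both end values, the other on the convexity along the segment. *)
suff H eta : 0 < eta ->
    ((t * vx + (1 - t) * vy - 2 * eta)%:E <= u (t *: x + (1 - t) *: y))%E.
  case E : (u _) => [v| |]; last 2 first.
  - by rewrite leey.
  - by have := H 1 ltr01; rewrite E.
  rewrite lee_fin; apply/ler_addgt0Pr => e e0.
  have := H (e / 2); rewrite E lee_fin => /(_ (divr_gt0 e0 (ltr0n _ 2))); lra.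
move=> eta0.
set d := x - y; pose L := dot d d.
have d0 : d != 0 by rewrite subr_eq0.
have L0 : 0 < L by exact: dot_gt0.
have Ln0 : L != 0 by rewrite gt_eqF.
(* [sg] is the coordinate along the segment, 0 at y and 1 at x; [w z] is the projection of z on the
   line. *)
pose sg z := dot (z - y) d / L.
pose w z := y + sg z *: d.
have csg : continuous sg.
  move=> z; apply: (@cvgMl _ _ (nbhs z)).
  by apply: (@cvg_dot _ _ (nbhs z)) => i; [exact: cvg_coordB|exact: cvg_cst].
have [m um] := supersolution_lower_bound oOmega su KO rho0.
have rho_gt0 : 0 < rho.
  rewrite lt_neqAle rho0 andbT; apply: contra_neq xy => rhoE.
  move: xr yr; rewrite -rhoE mul0r !normr_le0 !subr_eq0 => /eqP -> /eqP ->.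
  by [].
have near_lower v z : Omega z -> u z = v%:E -> exists2 r, 0 < r &
    forall z', `|z' - z| < r -> ((v - eta)%:E <= u z')%E.
  move=> Oz uz; have : ((v - eta)%:E < u z)%E by rewrite uz lte_fin ltrBlDr ltrDl.
  move=> /(lower_semicontinuous_near oOmega lu Oz) /nbhs_ballP[r r0 rP].
  exists r => // z' zz'; apply: ltW; apply: rP.
  by rewrite -ball_normE /ball_ /= distrC.
have [rx rx0 rxP] := near_lower vx x Ox ux.
have [ry ry0 ryP] := near_lower vy y Oy uy.
(* Within [dl] of an end point u has lost at most eta, and points within [dl] of the segment stay
   inside the ball. *)
pose dl := Num.min (Num.min rx ry) (rho / 2).
have dl0 : 0 < dl by rewrite !lt_min rx0 ry0 divr_gt0.
have dlx : dl <= rx by rewrite !ge_min lexx.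
have dly : dl <= ry by rewrite !ge_min lexx !orbT.
have dlr : dl <= rho / 2 by rewrite ge_min lexx orbT.
pose B := Num.max vx vy.
have Bx : vx <= B by rewrite le_max lexx.
have By : vy <= B by rewrite le_max lexx orbT.
have mx : m < vx by rewrite -lte_fin -ux um//; exact: ball_xy.
(* At distance [dl] from the line the penalty N dl^2 = B - m lowers the barrier to m or less. *)
pose N := (B - m) / dl ^+ 2.
have N0 : 0 < N by rewrite divr_gt0 ?exprn_gt0// subr_gt0 (lt_le_trans mx).
pose M : 'M[R]_n.+1 := (eta / L ^+ 2 + N / L) *: (d^T *m d) - N *: 1%:M.
have sM : Sym M.
  by rewrite /Sym /= /M linearB /= !linearZ /= trmx_mul trmxK trmx1.
have qM q : qform M q = (eta / L ^+ 2 + N / L) * dot q d ^+ 2 - N * dot q q.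
  rewrite /qform mulmxBr -!scalemxAr mulmx1 dotDl dotNl !dotZl mulmxA.
  by rewrite [q *m d^T]mx11_scalar -/(dot q d) mul_scalar_mx dotZl (dotC d q) expr2.
(* The extra - eta in the slope turns eta sg^2 into eta sg (sg - 1), so that [phi] equals vy - eta
   at y and vx - eta at x. *)
pose phi := quadratic (vy - eta) (((vx - vy - eta) / L) *: d) M y.
have pyth (e : 'rV[R]_n.+1) a : dot e d = a * L ->
    dot e e = dot (e - a *: d) (e - a *: d) + a ^+ 2 * L.
  move=> ed; rewrite !dotDl !dotDr !dotNl !dotNr !dotZl !dotZr (dotC d e) ed -/L.
  by ring.
have dist z : dot (z - y) (z - y) = dot (z - w z) (z - w z) + sg z ^+ 2 * L.
  have -> : z - w z = (z - y) - sg z *: d by rewrite opprD addrA.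
  by apply: pyth; rewrite /sg mulfVK.
have phiE z : phi z = vy + sg z * (vx - vy) - eta + eta * (sg z * (sg z - 1))
    - N * dot (z - w z) (z - w z).
  rewrite /phi /quadratic qM dotZl (dotC d) dist.
  have -> : dot (z - y) d = sg z * L by rewrite /sg mulfVK.
  by field.
pose z0 := t *: x + (1 - t) *: y.
have z0E : z0 - y = t *: d.
  by apply/rowP => i; rewrite /z0 /d !mxE; ring.
have ydx : y + d = x by rewrite /d addrC subrK.
have z0yE : z0 = y + t *: d by rewrite -z0E addrC subrK.
have sg0 : sg z0 = t by rewrite /sg z0E dotZl mulfK.
pose D := [set z | `|z - x0| <= rho] `&` [set z | 0 <= sg z <= 1].
have wr s : 0 <= s <= 1 -> `|y + s *: d - x0| <= rho / 2.
  move=> /andP[s0 s1].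
  have -> : y + s *: d - x0 = (1 - s) *: (y - x0) + s *: (x - x0).
    apply/rowP => i; rewrite !mxE; ring.
  rewrite (le_trans (ler_normD _ _))// !normrZ !ger0_norm ?subr_ge0//.
  have s1' : 0 <= 1 - s by rewrite subr_ge0.
  have := ler_wpM2l s1' yr; have := ler_wpM2l s0 xr; lra.
have cD : compact D.
  apply: compact_closedI; first exact: compact_ball_le.
  apply: (@preimage_closed _ _ sg [set s | 0 <= s <= 1]).
    by move=> z _; exact: csg.
  rewrite (_ : [set s | 0 <= s <= 1] = [set s : R | 0 <= s] `&` [set s : R | s <= 1]).
    by apply: closedI; [exact: closed_ge|exact: closed_le].
  by apply/seteqP; split=> s /= => [/andP[]|[-> ->]].
have Dz0 : D z0.
  split; last by rewrite /= sg0 t0 t1.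
  apply: ball_xy; have := wr t; rewrite t0 t1 => /(_ isT).
  by rewrite -z0yE.
have phiz0 : t * vx + (1 - t) * vy - 2 * eta <= phi z0.
  rewrite phiE sg0.
  have -> : z0 - w z0 = 0 by rewrite /w sg0 -z0yE subrr.
  rewrite [dot 0 0](_ : _ = 0) ?mulr0 ?subr0; last by rewrite /dot mul0mx mxE.
  have : eta * (t * (1 - t)) <= eta * 1.
    rewrite ler_pM2l//; have : t * (1 - t) <= 1 * 1 by apply: ler_pM => //; lra.
    by rewrite mulr1.
  nra.
apply: le_trans (_ : ((phi z0)%:E <= _)%E); first by rewrite lee_fin.
apply: (comparison oOmega su cD _ _ _ Dz0).
- by move=> z [/KO].
- exact: continuous_quadratic.
move=> z [/= zr /andP[s0 s1]].
have par : eta * (sg z * (sg z - 1)) <= 0.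
  by rewrite pmulr_rle0// mulr_ge0_le0// subr_le0.
have Nd : 0 <= N * dot (z - w z) (z - w z) by rewrite mulr_ge0 ?dot_ge0 ?ltW.
have [far|close] := leP dl `|z - w z|.
  left; apply: le_trans (ltW (um z zr)); rewrite lee_fin phiE.
  have : dl ^+ 2 <= dot (z - w z) (z - w z).
    apply: le_trans (norm_sqr_le_dot _).
    by rewrite ler_pXn2r ?nnegrE ?normr_ge0 ?(ltW dl0).
  move=> /(ler_wpM2l (ltW N0)); rewrite {1}/N divfK ?expf_neq0 ?gt_eqF//.
  have s1' : 0 <= 1 - sg z by rewrite subr_ge0.
  have := ler_wpM2l s1' By; have := ler_wpM2l s0 Bx; lra.
have [sg_0|sg_0] := eqVneq (sg z) 0.
  left; apply: le_trans (ryP z _); last first.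
    by apply: lt_le_trans dly; move: close; rewrite /w sg_0 scale0r addr0.
  by rewrite lee_fin phiE; move: par Nd; rewrite sg_0; lra.
have [sg_1|sg_1] := eqVneq (sg z) 1.
  left; apply: le_trans (rxP z _); last first.
    by apply: lt_le_trans dlx; move: close; rewrite /w sg_1 scale1r ydx.
  by rewrite lee_fin phiE; move: par Nd; rewrite sg_1; lra.
right; have [C2 HE] := hessian_quadratic (vy - eta) (((vx - vy - eta) / L) *: d) y z sM.
have zlt : `|z - x0| < rho.
  have -> : z - x0 = (z - w z) + (w z - x0) by rewrite addrA subrK.
  apply: le_lt_trans (ler_normD _ _) _.
  have := wr (sg z); rewrite s0 s1 -/(w z) => /(_ isT); lra.
split; [|exact: C2|].
  have n1 : \forall v \near z, `|v - x0| <= rho.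
    have cn : `|v - x0| @[v --> z] --> `|z - x0|.
      apply: (@cvg_norm _ _ _ (nbhs z)).
      by apply: (@cvgB _ _ _ (nbhs z)); [exact: cvg_id|exact: cvg_cst].
    by apply: filterS (cvgr_lt _ cn _ zlt) => v; exact: ltW.
  have n2 : \forall v \near z, 0 < sg v.
    by apply: (cvgr_gt (sg z) (csg z)); rewrite lt_neqAle eq_sym sg_0.
  have n3 : \forall v \near z, sg v < 1.
    by apply: (cvgr_lt (sg z) (csg z)); rewrite lt_neqAle sg_1.
  apply: filterS3 n1 n2 n3 => v vr v0 v1; split=> //=.
  by rewrite !ltW.
rewrite HE => /(_ d); rewrite !mul0r add0r subr0 mul1r.
rewrite /qform -scalemxAr dotZl -/(qform M d) qM -/L.
(* Along [d] the two N terms cancel and only the convexity 2 eta > 0 is left. *)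
have -> : 2 * ((eta / L ^+ 2 + N / L) * L ^+ 2 - N * L) = 2 * eta by field.
by apply/negP; rewrite -ltNge mulr_gt0.
Qed.

Lemma supersolution_locally_concave : locally_concave Omega u.
Proof.
have fin := @supersolution_fin R n Omega u 0 oOmega su.
have {}fin x : Omega x -> u x \is a fin_num by apply: fin; rewrite mul0r.
move=> x0 Ox0; have [rho rho0 KO] := open_ball_le_sub oOmega Ox0.
have r0 : 0 < rho / 2 by rewrite divr_gt0.
have inb z : ball x0 (rho / 2) z -> `|z - x0| <= rho / 2.
  by rewrite -ball_normE /ball_ /= distrC => /ltW.
have inO z : ball x0 (rho / 2) z -> Omega z.
  by move=> /inb zr; apply: KO => /=; lra.
exists (rho / 2) => //; split; [exact: inO|by move=> z /inO/fin|].
move=> t x y; rewrite !inE => xb yb.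
have [<-|xy] := eqVneq x y; first by rewrite !convmm.
have s01 : 0 <= t%:num <= (1 : R) by apply/andP; split.
pose s : R := t%:num; rewrite -/s in s01.
have cuv := supersolution_concave KO (inb _ xb) (inb _ yb) xy
  (esym (fineK (fin _ (inO _ xb)))) (esym (fineK (fin _ (inO _ yb)))) s01.
change (- fine (u (s *: x + (1 - s) *: y)) <=
  s * - fine (u x) + (1 - s) * - fine (u y)).
have zb : ball x0 (rho / 2) (s *: x + (1 - s) *: y).
  have /andP[s0 s1] := s01.
  rewrite -ball_normE /ball_ /= distrC.
  have -> : s *: x + (1 - s) *: y - x0 = s *: (x - x0) + (1 - s) *: (y - x0).
    by apply/rowP => i; rewrite !mxE; ring.
  move: xb yb; rewrite -ball_normE /ball_ /= !(distrC x0) => xb yb.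
  rewrite (le_lt_trans (ler_normD _ _))// !normrZ !ger0_norm ?subr_ge0//.
  have [->|sn0] := eqVneq s 0; first by rewrite mul0r add0r subr0 mul1r.
  have sp : 0 < s by rewrite lt_neqAle eq_sym sn0.
  have s1' : 0 <= 1 - s by rewrite subr_ge0.
  have := ler_wpM2l s1' (ltW yb); move: xb; rewrite -(ltr_pM2l sp); lra.
by move: cuv; rewrite -(fineK (fin _ (inO _ zb))) lee_fin; lra.
Qed.

End Concavity.

(** * Transfer to the individual equations and final deduction *)

Lemma dominated_supersolution_le0 (R : realType) (n : nat)
    (Omega : set 'rV[R]_n.+1) (u : 'rV[R]_n.+1 -> \bar R) (c : R)
    (L : ('rV[R]_n.+1 -> R) -> 'rV[R]_n.+1 -> R) :
  dominated_supersolution Omega u c ->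
  (forall phi x, C2_near phi x -> dominated c (hessian phi x) -> L phi x <= 0) ->
  viscosity_supersolution L Omega u.
Proof.
move=> su L0; have [? ? ? _] := su; split=> // x phi Ox C2 ux nx.
exact/L0/(supersolution_dominated su).
Qed.

Theorem corollary3p3p3 (R : realType) (n : nat) (F : 'M[R]_n -> R)
    (Omega : set 'rV[R]_n) (u : 'rV[R]_n -> \bar R) (alpha : R) :
  (2 <= n)%N ->
  rotationally_invariant F ->
  sublinear F ->
  degenerate_elliptic F ->
  (exists X : 'M[R]_n, Sym X /\ F X <> 0) ->
  Omega !=set0 ->
  open Omega ->
  viscosity_supersolution (fun phi x => F (hessian phi x)) Omega u ->
  is_solution_cone_aperture (associated_body F) alpha ->
  let p := body_cone_aperture n alpha in
  [/\ dominative_p_superharmonic p Omega u,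
      p_superharmonic p Omega u,
      superharmonic Omega u,
      ((n%:R)%:E < p)%E -> continuous_in Omega u
    & p = +oo%E -> locally_concave Omega u].
Proof.
case: n F Omega u => // m F Omega u m0 rotF subF ellF _ _ oO uF apF p.
have [/andP[a1 am] domF] := operator_dominated m0 rotF subF ellF apF.
set c := (alpha - 1) / m%:R in domF.
have mR : 0 < m%:R :> R by rewrite ltr0n.
have mn : m.+1%:R = m%:R + 1 :> R by rewrite natr1.
have cm : c * m%:R = alpha - 1 by rewrite /c divfK// gt_eqF.
have c01 : 0 <= c <= 1.
  by rewrite /c ler_pdivrMr// divr_ge0 ?subr_ge0 ?ler0n//= mul1r lerBlDr -mn.
have su : dominated_supersolution Omega u c.
  have [? ? ? uF'] := uF; split=> // x phi Ox C2 ux nx.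
  by case: asboolP => // -[]; apply: domF (hessian_sym C2) (uF' _ _ _ _ _ _).
have trH (phi : 'rV[R]_m.+1 -> R) x :
    C2_near phi x -> dominated c (hessian phi x) -> laplacian phi x <= 0.
  by move=> _ dH; rewrite laplacianE; exact: dominated_tr_le0 dH.
have lamH (phi : 'rV[R]_m.+1 -> R) x : C2_near phi x -> dominated c (hessian phi x) ->
    c * laplacian phi x + (1 - c) * lambda_max (hessian phi x) <= 0.
  by move=> /hessian_sym sH dH; rewrite laplacianE; exact: dominated_lambda_max.
have conc : c * m%:R < 1 -> continuous_in Omega u.
  exact: supersolution_continuous.
have superh : superharmonic Omega u := dominated_supersolution_le0 su trH.
rewrite /p /body_cone_aperture; case: eqVneq => [alpha1|alpha1].
  have c0 : c = 0 by rewrite /c alpha1 subrr mul0r.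
  split=> //.
  - apply: dominated_supersolution_le0 su _ => phi x C2 dH /=.
    by have := lamH _ _ C2 dH; rewrite c0 mul0r add0r subr0 mul1r.
  - apply: dominated_supersolution_le0 su _ => phi x _.
    by rewrite c0; exact: p_laplacian_pinfty_le0.
  - by move=> _; apply: conc; rewrite c0 mul0r.
  - by move=> _; apply: supersolution_locally_concave => //; rewrite -c0.
have a0 : 0 < alpha - 1 by rewrite subr_gt0 lt_neqAle eq_sym alpha1.
have c0 : 0 < c by rewrite divr_gt0.
set r := _ / _.
(* Multiplied by c > 0, the weights r - 2 and 1 of the two operators become 1 - c and c. *)
have cr : c * (r - 2) = 1 - c.
  rewrite /r /c mn; field; rewrite !gt_eqF//.
split=> //.
- apply: dominated_supersolution_le0 su _ => phi x C2 dH /=.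
  rewrite -(pmulr_rle0 _ c0) mulrDr mulrA cr addrC; exact: lamH.
- apply: dominated_supersolution_le0 su _ => phi x C2.
  apply: p_laplacian_fin_le0 cr => //.
  by rewrite c0; case/andP: c01.
(* With n = m + 1, p > n amounts to alpha - 1 < 1, that is c m < 1. *)
- rewrite lte_fin /r ltr_pdivlMr// mn => np; apply: conc.
  have : m%:R * (alpha - 1) < m%:R * 1 by lra.
  by rewrite cm ltr_pM2l.
Qed.
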